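(* For every recursive (decidable) set $A\subseteq\{0,1\}^*$ with $A\notin \mathrm{NP}\cap\mathrm{coNP}$, there exists a set $B$ such that $A\le_T^{SN}B$ and $A\not\le_T^{RS}B$.
   Context: An NPTM is a nondeterministic oracle Turing machine $N$ each of whose computation paths ends in one of three outcomes $\mathbf{acc}$, $\mathbf{rej}$, $\mathbf{?}$, such that there is a polynomial $p$ with: for every oracle $D$ and every input $x$, every computation path of $N^D(x)$ has length at most $p(|x|)$. For an oracle $D$ and input $x$, let $out_{N^D}(x)$ be the set of outcomes occurring on some path of $N^D(x)$; $L(N^D)=\{x:\mathbf{acc}\in out_{N^D}(x)\}$. $N^D(x)$ is underproductive if $\{\mathbf{acc},\mathbf{rej}\}\not\subseteq out_{N^D}(x)$, and overproductive if $out_{N^D}(x)\neq\{\mathbf{?}\}$; $N^D$ is underproductive (overproductive) if $N^D(x)$ is so for every $x$. $N$ is robustly underproductive (overproductive) if $N^D$ is underproductive (overproductive) for every oracle $D$. $A\le_T^{SN}B$ if there is an NPTM $N$ with $N^B$ both overproductive and underproductive and $A=L(N^B)$. $A\le_T^{RS}B$ if this holds via an $N$ that is both robustly overproductive and robustly underproductive. *)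

(* Defs.v *)
From HB Require Import structures.
From mathcomp Require Import all_boot all_order all_algebra.
From mathcomp Require Import boolp classical_sets.

Set Implicit Arguments.
Unset Strict Implicit.
Unset Printing Implicit Defensive.

Local Open Scope classical_set_scope.

Notation word := (seq bool).
Notation language := (set word).

Inductive outcome : Type := Acc | Rej | Unk.

Inductive move : Type := MoveLeft | Stay | MoveRight.

Definition move_code (m : move) : option bool :=
  match m with MoveLeft => Some false | Stay => None | MoveRight => Some true end.

Definition move_decode (o : option bool) : move :=
  match o with Some false => MoveLeft | None => Stay | Some true => MoveRight end.

Lemma move_codeK : cancel move_code move_decode.
Proof. by case. Qed.

HB.instance Definition _ := Countable.copy move (can_type move_codeK).
HB.instance Definition _ : isFinite move := CanIsFinite move_codeK.

(* [Ask y n] queries the oracle and continues in state [y] if the answer is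
   positive, and in state [n] otherwise. *)
Inductive state_kind (Q : Type) : Type :=
  | Compute
  | Ask of Q & Q
  | Halt of outcome.
Arguments Compute {Q}.
Arguments Halt {Q} _.

(* [None] is the blank, [Some (inl b)] the bit [b], and [Some (inr a)] an
   auxiliary work symbol. *)
Definition symbol (aux : finType) : finType := option (bool + aux).

(* A nondeterministic oracle Turing machine with [ntapes.+1] two-way infinite
   tapes and one write-only oracle tape.  In a transition, the last component
   [Some b] appends the bit [b] to the oracle tape and [None] leaves it
   unchanged.  [trans q] is only used when [kind q] is [Compute]. *)
Record machine : Type := Machine {
  state : finType;
  aux : finType;
  ntapes : nat;
  start : state;
  kind : state -> state_kind state;
  trans : state -> {ffun 'I_ntapes.+1 -> symbol aux} ->
    {set state * {ffun 'I_ntapes.+1 -> symbol aux * move} * option bool}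
}.

(* The tape [(l, r)] has [l] to the left of the head, nearest cell first, and
   [r] from the scanned cell rightwards; all other cells are blank. *)
Definition tape (aux : finType) : Type := (seq (symbol aux) * seq (symbol aux))%type.

Definition read (aux : finType) (t : tape aux) : symbol aux := head None t.2.

Definition write_move (aux : finType) (t : tape aux) (a : symbol aux * move) :
    tape aux :=
  match a.2 with
  | MoveLeft => (behead t.1, head None t.1 :: a.1 :: behead t.2)
  | Stay => (t.1, a.1 :: behead t.2)
  | MoveRight => (a.1 :: t.1, behead t.2)
  end.

Record config (N : machine) : Type := Config {
  cstate : state N;
  ctapes : {ffun 'I_(ntapes N).+1 -> tape (aux N)};
  coracle : word
}.

Definition init (N : machine) (x : word) : config N :=
  Config (start N)
    [ffun i => if i == ord0 then ([::], [seq Some (inl b) | b <- x])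
               else ([::], [::])]
    [::].

Definition append (w : word) (o : option bool) : word :=
  if o is Some b then rcons w b else w.

(* A query is answered in one step, which also erases the oracle tape. *)
Definition step (N : machine) (D : language) (c c' : config N) : Prop :=
  match kind (cstate c) with
  | Compute =>
      exists2 a, a \in trans (cstate c) [ffun i => read (ctapes c i)] &
        c' = Config a.1.1 [ffun i => write_move (ctapes c i) (a.1.2 i)]
               (append (coracle c) a.2)
  | Ask y n =>
      (D (coracle c) /\ c' = Config y (ctapes c) [::]) \/
      (~ D (coracle c) /\ c' = Config n (ctapes c) [::])
  | Halt _ => False
  end.

Fixpoint steps (N : machine) (D : language) (n : nat) (c c' : config N) : Prop :=
  if n is m.+1 then exists2 d, step D c d & steps D m d c' else c = c'.

Definition nptm (N : machine) : Prop :=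
  (forall (D : language) (x : word) (n : nat) (c : config N),
     steps D n (init N x) c ->
     (exists o, kind (cstate c) = Halt o) \/ (exists c', step D c c')) /\
  (exists p : {poly nat},
     forall (D : language) (x : word) (n : nat) (c : config N),
       steps D n (init N x) c -> n <= p.[size x]%R).

Definition out (N : machine) (D : language) (x : word) : set outcome :=
  [set o | exists n c, steps D n (init N x) c /\ kind (cstate c) = Halt o].

Definition lang (N : machine) (D : language) : language :=
  [set x | out N D x Acc].

Definition underproductive (N : machine) (D : language) : Prop :=
  forall x, ~ ([set Acc; Rej] `<=` out N D x).

Definition overproductive (N : machine) (D : language) : Prop :=
  forall x, out N D x <> [set Unk].

Definition robustly_underproductive (N : machine) : Prop :=
  forall D : language, underproductive N D.

Definition robustly_overproductive (N : machine) : Prop :=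
  forall D : language, overproductive N D.

Definition le_SN (A B : language) : Prop :=
  exists N : machine,
    [/\ nptm N, overproductive N B, underproductive N B & A = lang N B].

Definition le_RS (A B : language) : Prop :=
  exists N : machine,
    [/\ nptm N, robustly_overproductive N, robustly_underproductive N
      & A = lang N B].

Definition oracle_free (N : machine) : Prop :=
  forall q y n, kind q <> Ask y n :> state_kind (state N).

Definition deterministic (N : machine) : Prop :=
  forall (q : state N) r, (#|trans q r| <= 1)%N.

(* The runs of an oracle-free machine do not depend on the oracle, for which
   [set0] is a dummy value. *)
Definition recursive (A : language) : Prop :=
  exists M : machine,
    [/\ oracle_free M, deterministic M &
        forall x, (A x -> out M set0 x Acc) /\ (~ A x -> out M set0 x Rej)].

Definition NP : set language :=
  [set A | exists N : machine, [/\ nptm N, oracle_free N & A = lang N set0]].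

Definition coNP : set language := [set A | NP (~` A)].

(* Main.v *)
(** [correct_codes A B] says that, for every [x], [B] contains a word
   [code x y b] for some witness [y] of length [|x| + 1], and that it does so
   only for the right answer [b]; guessing [y] and [b] then gives
   [A <=_T^SN B].  Such a [B] is built as a limit of finite extensions, against
   countably many machines.  Diagonalising against a robust [N] can only fail at
   a stage when all correct [B] beyond a finite prefix satisfy [A = L(N^B)].
   In that case [A] is in NP and coNP.  Enumerate the words as [z_0], [z_1], ...
   and let [D_i] be the prefix together with the codes, with all-zero witness,
   of the words [z_j], [j < i].  A path of [N^{D_i}(x)] that is short
   compared with [2^|z|] for every [z = z_j] with [j >= i] misses a witness for
   each of these [z], so it is also a path of [N^B(x)] for some correct [B], and
   its verdict on [x] is right.  As [N] is robust, some path does end in a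
   verdict, so a nondeterministic machine can compute the answers for
   [z_i], [z_(i+1)], ... one after the other, each time with the table of the
   answers found so far in place of the oracle.  After polynomially many words
   the table is long enough for the verdict of [N] on the input itself.

   That machine is written for stacks instead of tapes, and a clock made of
   stacks keeps all its paths polynomial. *)

From HB Require Import structures.
Require Import Defs.
From mathcomp Require Import all_boot all_order all_algebra.
From mathcomp Require Import boolp classical_sets.
From mathcomp Require Import zify.

Set Implicit Arguments.
Unset Strict Implicit.
Unset Printing Implicit Defensive.

Local Open Scope classical_set_scope.

(** * Nondeterministic stack machines *)

(** The oracle [D_i] is not itself correct, since the words from [z_i] on have no code in it.
    Overproductivity is used at [D_i], where it provides a path with a verdict. Underproductivity is
    used at the correct [B] to which this path is transferred: there it forces a verdict [Rej] to be
    right.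

    The obstacle is the last run. For [z_i] itself the time bound of [N] is below [2^(|z_i|+1)] once
    the prefix is long enough, but the input may be far longer than the words in the table, and the
    machine may guess to stop filling the table too early. So each computed answer buys one step of
    the last run. Witnesses have length [|z| + 1] because [z_j] then has more than [j] of them: a
    run paid for by the answers computed so far is always short enough to be trusted, and a
    premature stop only loses the path. *)

Variant op (S : Type) : Type := Pop | Put of S | Put2 of S & S.
Arguments Pop {S}.

Definition act (S : Type) (u : op S) (s : seq S) : seq S :=
  match u with
  | Pop => behead s
  | Put a => a :: behead s
  | Put2 a b => [:: a, b & behead s]
  end.

(** An operation overwrites the top letter, as a tape head does, so leaving a stack alone or pushing
    on it depends on the letter read there. *)
Definition keep (S : Type) (t : option S) : op S :=
  if t is Some a then Put a else Pop.

Definition push (S : Type) (a : S) (t : option S) : op S :=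
  if t is Some b then Put2 a b else Put a.

Lemma act_keep S (s : seq S) : act (keep (ohead s)) s = s.
Proof. by case: s. Qed.

Lemma act_push S (a : S) (s : seq S) : act (push a (ohead s)) s = a :: s.
Proof. by case: s. Qed.

(** Only acceptance matters, so there are no other outcomes and a path may get stuck.
    [sload v (Some b)] is the letter, if any, that an input bit [b] pushes on stack [v];
    [sload v None] is the one pushed at the end of the input. *)
Record smachine : Type := SMachine {
  sstate : finType;
  stack : finType;
  saux : finType;
  sstart : sstate;
  sfinal : pred sstate;
  sload : stack -> option bool -> option (bool + saux);
  sdelta : sstate -> (stack -> option (bool + saux)) -> sstate ->
           (stack -> op (bool + saux)) -> Prop
}.

Definition store (M : smachine) : Type := stack M -> seq (bool + saux M).

Definition tops (M : smachine) (st : store M) : stack M -> option (bool + saux M) :=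
  fun v => ohead (st v).

Definition sstep (M : smachine) (c c' : sstate M * store M) : Prop :=
  exists2 u, sdelta c.1 (tops c.2) c'.1 u & c'.2 = fun v => act (u v) (c.2 v).

Fixpoint ssteps (M : smachine) (n : nat) (c c' : sstate M * store M) : Prop :=
  if n is m.+1 then exists2 d, sstep c d & ssteps m d c' else c = c'.

Definition load (M : smachine) (o : option bool) (st : store M) : store M :=
  fun v => if sload v o is Some a then a :: st v else st v.

Definition sinit (M : smachine) (x : word) : sstate M * store M :=
  (sstart M,
   load None (foldl (fun st b => load (Some b) st) (fun=> [::]) x)).

Definition sacc (M : smachine) (n : nat) (c : sstate M * store M) : Prop :=
  exists2 c', ssteps n c c' & sfinal c'.1.

Lemma steps_cat N D m n (c c' c'' : config N) :
  steps D m c c' -> steps D n c' c'' -> steps D (m + n) c c''.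
Proof.
elim: m c => [|m IH] c /=; first by move=> ->.
by case=> d cd dc' c'c''; exists d => //; apply: IH.
Qed.

(** * Stack machines on Turing tapes *)

Section Compile.
Variable M : smachine.
Notation S := (bool + saux M)%type.

Definition tidx (v : stack M) : 'I_#|stack M|.+1 := lift ord0 (enum_rank v).

Definition tpack (T : Type) (f0 : T) (f : stack M -> T) :
    {ffun 'I_#|stack M|.+1 -> T} :=
  [ffun i => if unlift ord0 i is Some j then f (enum_val j) else f0].

Lemma tpack0 T (f0 : T) f : tpack f0 f ord0 = f0.
Proof. by rewrite ffunE unlift_none. Qed.

Lemma tpackS T (f0 : T) f v : tpack f0 f (tidx v) = f v.
Proof. by rewrite ffunE liftK enum_rankK. Qed.

Definition load_op (o : option bool) (t : stack M -> option S) (v : stack M) :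
    op S :=
  if sload v o is Some a then push a (t v) else keep (t v).

(* Phase [None] loads the input onto the stacks, phase [Some q] runs [M]. *)
Definition ready (p : option (sstate M)) (s : symbol (saux M))
    (t : stack M -> option S) (p' : option (sstate M)) (u : stack M -> op S)
    (m : move) : Prop :=
  match p with
  | Some q => exists2 q', sdelta q t q' u & p' = Some q' /\ m = Stay
  | None =>
      if s is Some (inl b) then [/\ p' = None, m = MoveRight & u = load_op (Some b) t]
      else [/\ p' = Some (sstart M), m = Stay & u = load_op None t]
  end.

(* The stack is the part of the tape from the scanned cell rightwards.  A
   [Put2] takes two steps, the second of which writes the [pending] symbol. *)
Definition first_action (u : op S) (r : symbol (saux M)) :
    symbol (saux M) * move :=
  match u with
  | Pop => (r, if r is Some _ then MoveRight else Stay)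
  | Put a => (Some a, Stay)
  | Put2 _ b => (Some b, MoveLeft)
  end.

Definition pending (u : op S) : option S := if u is Put2 a _ then Some a else None.

Definition second_action (p : option S) (r : symbol (saux M)) :
    symbol (saux M) * move :=
  (if p is Some a then Some a else r, Stay).

Definition tape_state : finType :=
  option (option (sstate M) * option {ffun stack M -> option S}).

Definition tape_kind (q : tape_state) : state_kind tape_state :=
  match q with
  | None => Halt Unk
  | Some (Some q, None) => if sfinal q then Halt Acc else Compute
  | _ => Compute
  end.

(** A jump to the sink [None], which halts with [Unk], is always offered: [sdelta] may allow no step
    at all, whereas an NPTM path has to end in a halting state. *)
Definition tape_trans (q : tape_state) (r : {ffun 'I_#|stack M|.+1 -> symbol (saux M)}) :
    {set tape_state * {ffun 'I_#|stack M|.+1 -> symbol (saux M) * move} * option bool} :=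
  match q with
  | None => finset.set0
  | Some (p, Some f) =>
      [set (Some (p, None),
            tpack (r ord0, Stay) (fun v => second_action (f v) (r (tidx v))),
            None)]%SET
  | Some (p, None) =>
      [set a | `[< a = (None, [ffun i => (r i, Stay)], None) \/
         exists p' u m, ready p (r ord0) (fun v => r (tidx v)) p' u m /\
           a = (Some (p', Some [ffun v => pending (u v)]),
                tpack (r ord0, m) (fun v => first_action (u v) (r (tidx v))),
                None) >]]%SET
  end.

Definition compile : machine := Machine (Some (None, None)) tape_kind tape_trans.

(** The left part of the tape is arbitrary, because a [Put2] overwrites the cell it moves onto.
    Trailing blanks arise when a blank is written under the head on an empty stack. *)
Definition holds (t : tape (saux M)) (s : seq S) : Prop :=
  exists j, t.2 = [seq Some a | a <- s] ++ nseq j None.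

Lemma read_holds t s : holds t s -> read t = ohead s.
Proof. by case=> j; rewrite /read => ->; case: s => //; case: j. Qed.

Lemma holds_act t s u : holds t s ->
  let t1 := write_move t (first_action u (read t)) in
  holds (write_move t1 (second_action (pending u) (read t1))) (act u s).
Proof.
move=> h; rewrite (read_holds h); case: t h => l r [j /= ->].
case: u => [|a|a b] /=.
- case: s => [|a [|b s]] /=; first by case: j => [|j]; [exists 1|exists j.+1].
    by case: j => [|j]; [exists 1 | exists j.+1].
  by exists j.
- by case: s => [|c s] /=; [exists j.-1; case: j | exists j].
- by case: s => [|c s] /=; [exists j.-1; case: j | exists j].
Qed.

Definition simulates (c : config compile) (a : option (sstate M) * word * store M) : Prop :=
  [/\ cstate c = Some (a.1.1, None) :> tape_state,
      a.1.1 = None -> holds (ctapes c ord0) [seq inl b | b <- a.1.2] &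
      forall v, holds (ctapes c (tidx v)) (a.2 v)].

Definition astep (a a' : option (sstate M) * word * store M) : Prop :=
  exists u m, [/\ ready a.1.1 (ohead [seq inl b | b <- a.1.2]) (tops a.2) a'.1.1 u m,
    a'.1.2 = if m is MoveRight then behead a.1.2 else a.1.2 &
    a'.2 = fun v => act (u v) (a.2 v)].

Fixpoint asteps n a a' : Prop :=
  if n is m.+1 then exists2 d, astep a d & asteps m d a' else a = a'.

Definition ainit (x : word) : option (sstate M) * word * store M :=
  (None, x, fun=> [::]).

Definition afinal (a : option (sstate M) * word * store M) : Prop :=
  if a.1.1 is Some q then sfinal q else false.

Lemma simulates_init x : simulates (init compile x) (ainit x).
Proof.
split=> //= [_|v]; rewrite ?ffunE ?eqxx //.
  by exists 0; rewrite cats0 -map_comp.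
by exists 0; rewrite eq_sym (negbTE (neq_lift _ _)).
Qed.

Lemma load_opE o st v : act (load_op o (tops st) v) (st v) = load o st v.
Proof.
by rewrite /load_op /load /tops; case: sload => [a|]; rewrite ?act_keep ?act_push.
Qed.

Definition halfway (D : language) (d : config compile) a' : Prop :=
  [/\ kind (cstate d) = Compute, exists c', step D d c' &
      forall c', step D d c' -> simulates c' a'].

Lemma rep_read c a : simulates c a ->
  (fun v => [ffun i => read (ctapes c i)] (tidx v)) = tops a.2.
Proof. by case=> _ _ h; apply/funext => v /=; rewrite ffunE (read_holds (h v)). Qed.

Lemma rep_ready c a p' u m : simulates c a ->
  ready a.1.1 ([ffun i => read (ctapes c i)] ord0) (tops a.2) p' u m <->
  ready a.1.1 (ohead [seq inl b | b <- a.1.2]) (tops a.2) p' u m.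
Proof.
case: a => -[[q|] w] st [/= _ h _] //.
by rewrite ffunE (read_holds (h _)).
Qed.

Lemma ready_tape0 (c : config compile) (a : option (sstate M) * word * store M) p' u m : simulates c a ->
  ready a.1.1 (ohead [seq inl b | b <- a.1.2]) (tops a.2) p' u m -> p' = None ->
  let t := write_move (ctapes c ord0) (read (ctapes c ord0), m) in
  holds (write_move t (read t, Stay))
    [seq inl b | b <- if m is MoveRight then behead a.1.2 else a.1.2].
Proof.
case: a => -[[q|] w] st [/= _ h _]; first by case=> q' _ [-> _].
move: (h erefl) => {h}; case: (ctapes c ord0) => l r [j /= ->] + p'N.
case: w => [|b w] /=; first by rewrite p'N => -[].
move=> [_ -> _]; case: w => [|b' w] /=; last by exists j.
by exists (j.-1).+1; case: j.
Qed.

Lemma rep_compute c a : simulates c a -> ~ afinal a -> kind (cstate c) = Compute.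
Proof.
case=> -> _ _ /=; rewrite /afinal; case: a.1.1 => //= q /negP/negbTE ->.
by [].
Qed.

Lemma step_pending D (d : config compile) p f :
  cstate d = Some (p, Some f) :> tape_state ->
  kind (cstate d) = Compute /\ forall c', step D d c' <->
  c' = Config (Some (p, None) : state compile)
    [ffun i => write_move (ctapes d i)
      (tpack (read (ctapes d ord0), Stay)
         (fun v => second_action (f v) (read (ctapes d (tidx v)))) i)]
    (coracle d).
Proof.
move=> ds; have dk : kind (cstate d) = Compute by rewrite ds /=; case: p {ds}.
split=> // c'; rewrite /step dk ds /=.
have -> : (fun v => second_action (f v) ([ffun i => read (ctapes d i)] (tidx v)))
  = (fun v => second_action (f v) (read (ctapes d (tidx v)))).
  by apply/funext => v; rewrite ffunE.
rewrite ffunE; split; first by case=> a /set1P -> ->.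
by move=> ->; eexists; [apply/set1P; reflexivity|].
Qed.

Lemma mid_pending D (c : config compile) a a' u m : simulates c a ->
  ready a.1.1 (ohead [seq inl b | b <- a.1.2]) (tops a.2) a'.1.1 u m ->
  a'.1.2 = (if m is MoveRight then behead a.1.2 else a.1.2) ->
  a'.2 = (fun v => act (u v) (a.2 v)) ->
  halfway D (Config (Some (a'.1.1, Some [ffun v => pending (u v)]) : state compile)
    [ffun i => write_move (ctapes c i)
     (tpack (read (ctapes c ord0), m)
        (fun v => first_action (u v) (read (ctapes c (tidx v)))) i)] (coracle c)) a'.
Proof.
move=> hr rd w' st'; have [cs h0 hv] := hr.
set d := Config _ _ _.
have [dk dN] := @step_pending D d _ _ erefl.
split=> //; first by eexists; apply/dN; reflexivity.
move=> c' /dN ->; split=> //=.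
- by move=> a'N; rewrite ffunE tpack0 ffunE tpack0 w'; exact: (ready_tape0 hr rd a'N).
- move=> v; rewrite ffunE tpackS (ffunE (fun v => pending (u v))) ffunE tpackS st'.
  exact: holds_act.
Qed.

Lemma first_step D (c d : config compile) a : simulates c a -> ~ afinal a ->
  step D c d <-> 
  d = Config (None : state compile)
        [ffun i => write_move (ctapes c i) (read (ctapes c i), Stay)] (coracle c) \/
  exists p' u m, ready a.1.1 (ohead [seq inl b | b <- a.1.2]) (tops a.2) p' u m /\
    d = Config (Some (p', Some [ffun v => pending (u v)]) : state compile)
    [ffun i => write_move (ctapes c i)
     (tpack (read (ctapes c ord0), m)
        (fun v => first_action (u v) (read (ctapes c (tidx v)))) i)] (coracle c).
Proof.
move=> hr nf; have [cs h0 hv] := hr.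
have nE : [ffun i => ([ffun i0 => read (ctapes c i0)] i, Stay)] =
  [ffun i => (read (ctapes c i), Stay)] by apply/ffunP => i; rewrite !ffunE.
have fE u : (fun v => first_action (u v) ([ffun i => read (ctapes c i)] (tidx v)))
  = (fun v => first_action (u v) (read (ctapes c (tidx v)))).
  by apply/funext => v; rewrite ffunE.
have dE : [ffun i => write_move (ctapes c i) ([ffun i => (read (ctapes c i), Stay)] i)]
  = [ffun i => write_move (ctapes c i) (read (ctapes c i), Stay)].
  by apply/ffunP => i; rewrite !ffunE.
rewrite /step (rep_compute hr nf) cs; split.
  case=> b; rewrite inE => /asboolP [|[p' [u [m [rd ->]]]]].
    by move=> -> ->; left; rewrite /= nE dE.
  rewrite (rep_read hr) in rd; move/(rep_ready _ _ _ hr): rd => rd ->.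
  by right; exists p', u, m; rewrite /= fE (ffunE (fun i => read (ctapes c i))).
case=> [->|[p' [u [m [rd ->]]]]].
  exists (None, [ffun i => (read (ctapes c i), Stay)], None); last by rewrite /= dE.
  by rewrite inE; apply/asboolP; left; rewrite nE.
eexists; first by rewrite inE; apply/asboolP; right; exists p', u, m; split;
  [rewrite (rep_read hr); apply/(rep_ready _ _ _ hr)|reflexivity].
by rewrite /= fE (ffunE (fun i => read (ctapes c i))).
Qed.

Lemma astep_step D c a a' : simulates c a -> ~ afinal a -> astep a a' ->
  exists2 d, step D c d & halfway D d a'.
Proof.
move=> hr nf [u [m [rd w' st']]]; eexists.
  by apply/(first_step D _ hr nf); right; exists a'.1.1, u, m; split; [|reflexivity].
exact: (mid_pending D hr rd w' st').
Qed.

Lemma step_astep D c a d : simulates c a -> step D c d ->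
  kind (cstate d) = Halt Unk \/ exists2 a', astep a a' & halfway D d a'.
Proof.
move=> hr; have [f|nf] := pselect (afinal a).
  rewrite /step; have [-> _ _] := hr; move: f; rewrite /afinal /=.
  by case: a.1.1 => //= q ->.
move/(first_step D _ hr nf) => [->|[p' [u [m [rd ->]]]]]; first by left.
pose a' : option (sstate M) * word * store M :=
  (p', if m is MoveRight then behead a.1.2 else a.1.2, fun v => act (u v) (a.2 v)).
right; exists a'; first by exists u, m.
exact: (@mid_pending D c a a' u m hr rd).
Qed.

Lemma afinal_halt (c : config compile) a : simulates c a -> afinal a <-> kind (cstate c) = Halt Acc.
Proof.
case=> -> _ _ /=; rewrite /afinal; case: a.1.1 => //= q.
by case: sfinal.
Qed.

Lemma rep_live D c a : simulates c a ->
  (exists o, kind (cstate c) = Halt o) \/ exists c', step D c c'.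
Proof.
move=> hr; have [cs _ _] := hr.
have [f|nf] := pselect (afinal a).
  by left; exists Acc; apply/(afinal_halt hr).
right; eexists; rewrite /step (rep_compute hr nf) cs.
by eexists; [rewrite inE; apply/asboolP; left; reflexivity|reflexivity].
Qed.

(** Every stack step takes two tape steps. The odd step in the bound is the first half of an
    unfinished stack step, or the jump to the sink. *)
Lemma rep_steps D n c a c' : simulates c a -> steps D n c c' ->
  exists m a', [/\ asteps m a a', n <= m.*2.+1,
    kind (cstate c') = Halt Acc -> afinal a' &
    (exists o, kind (cstate c') = Halt o) \/ exists c'', step D c' c''].
Proof.
elim/ltn_ind: n c a => -[|n] IH c a hr.
  move=> <-; exists 0, a; split=> //.
  - by move/(afinal_halt hr).
  - exact: rep_live hr.
case=> d cd dc'; have [dU|[a' aa' [dC dE dN]]] := step_astep hr cd.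
  case: n dc' {IH} => [<-|n [c'' + _]]; last by rewrite /step dU.
  by exists 0, a; split; rewrite ?dU //; left; exists Unk.
case: n dc' IH => [<- _|n [c'' dc'' c''c'] IH].
  by exists 0, a; split; rewrite ?dC //; right.
have [m [a'' [ha hn hacc hl]]] := IH n (ltnW (ltnSn _)) c'' a' (dN _ dc'') c''c'.
by exists m.+1, a''; split=> //; exists a'.
Qed.

Lemma asteps_steps D m a a' c : simulates c a -> asteps m a a' -> afinal a' ->
  exists n c', steps D n c c' /\ kind (cstate c') = Halt Acc.
Proof.
elim: m c a => [|m IH] c a hr /=.
  by move=> <- /(afinal_halt hr) h; exists 0, c.
(* The tape machine halts in the first final state, so any later stack steps are dropped. *)
have [f|nf] := pselect (afinal a).
  by move=> _ _; exists 0, c; split=> //; apply/(afinal_halt hr).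
case=> a1 aa1 a1a' f.
have [d cd [_ [c1 dc1] h]] := astep_step D hr nf aa1.
have [n [c' [st hc']]] := IH _ _ (h _ dc1) a1a' f.
by exists n.+2, c'; split=> //; exists d => //; exists c1.
Qed.

Lemma asteps_run m q (st : store M) w a : asteps m (Some q, w, st) a ->
  exists2 c, ssteps m (q, st) c & a = (Some c.1, w, c.2).
Proof.
elim: m q st => [|m IH] q st /=; first by move=> <-; exists (q, st).
case=> -[[p' w'] st'] [u [mv [/= [q' d [-> ->]] -> ->]]] /IH [c h ->].
by exists c => //; exists (q', fun v => act (u v) (st v)) => //; exists u.
Qed.

Lemma run_asteps m c (w : word) c' : ssteps m c c' ->
  asteps m (Some c.1, w, c.2) (Some c'.1, w, c'.2).
Proof.
elim: m c => [|m IH] c /=; first by move=> ->.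
case=> d [u du dE] /IH h; exists (Some d.1, w, d.2) => //.
by exists u, Stay; split=> //; exists d.1.
Qed.

Definition loads x (st : store M) : store M :=
  load None (foldl (fun st b => load (Some b) st) st x).

Lemma asteps_init m (x : word) st a : asteps m (None, x, st) a ->
  (m <= size x + 1 /\ ~ afinal a) \/
  exists k w c, [/\ m = size x + 1 + k, ssteps k (sstart M, loads x st) c &
    a = (Some c.1, w, c.2)].
Proof.
elim: m x st => [|m IH] x st /=; first by move=> <-; left.
case=> -[[p' w'] st'] [u [mv [/= rd -> ->]]].
case: x rd => [|b x] /= [-> -> ->].
  have -> : (fun v => act (load_op None (tops st) v) (st v)) = load None st.
    by apply/funext => v; rewrite load_opE.
  by move/asteps_run => [c h ->]; right; exists m, [::], c; rewrite add0n add1n.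
have -> : (fun v => act (load_op (Some b) (tops st) v) (st v)) = load (Some b) st.
  by apply/funext => v; rewrite load_opE.
move/IH => [[h1 h2]|[k [w [c [-> h ->]]]]]; first by left.
by right; exists k, w, c; rewrite !addSn.
Qed.

Lemma init_asteps (x : word) st k c : ssteps k (sstart M, loads x st) c ->
  exists m, asteps m (None, x, st) (Some c.1, [::], c.2).
Proof.
elim: x st => [|b x IH] st /=.
  move=> /run_asteps h; exists k.+1; exists (Some (sstart M), [::], load None st).
    exists (load_op None (tops st)), Stay; split=> //.
    by apply/funext => v; rewrite load_opE.
  exact: h.
move=> /IH [m h]; exists m.+1; exists (None, x, load (Some b) st) => //.
exists (load_op (Some b) (tops st)), MoveRight; split=> //.
by apply/funext => v; rewrite load_opE.
Qed.

Lemma compile_NP (p : {poly nat}) :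
  (forall x n c, ssteps n (sinit M x) c -> n <= p.[size x]%R) ->
  NP [set x | exists n, sacc n (sinit M x)].
Proof.
move=> pP; exists compile; split.
- split=> [D x n c /(rep_steps (simulates_init x)) [m [a [_ _ _ h]]] //|].
  (* Two tape steps for each of the [size x + 1] loading steps and the at most [p] steps of [M], and
     the odd last step. *)
  exists ((p + 'X + 1%:P)%R + (p + 'X + 1%:P) + 1%:P)%R => D x n c /(rep_steps (simulates_init x)).
  move=> [m [a [am nm _ _]]].
  rewrite !hornerE; apply: (leq_trans nm).
  case: (asteps_init am) => [[h _]|[k [w [c' [h /pP]]]]].
    by rewrite -addnn; move: h; set pp := p.[_]%R; rewrite /GRing.add /GRing.one /=; lia.
  by rewrite -addnn; move: h; set pp := p.[_]%R; rewrite /GRing.add /GRing.one /=; lia.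
- move=> q y n /=; case: q => [[[q|] [f|]]|] //=.
  by case: ifP.
- apply/seteqP; split=> x /=.
    move=> [n [c h f]].
    have [m h'] := init_asteps h.
    have [k [c' [hk hc]]] := asteps_steps set0 (simulates_init x) h' f.
    by exists k, c'.
  move=> [n [c [/(rep_steps (simulates_init x)) [m [a [am _ h _]]] /h f]]].
  case: (asteps_init am) => [[_ /(_ f)]//|[k [w [c' [_ hk aE]]]]].
  by exists k, c' => //; move: f; rewrite aE.
Qed.
End Compile.

(** * Clocks *)

(** With [z j] meaning that digit [j] is zero, this says that the borrow of a decrement reaches
    digit [i]. *)
Definition low k (z : 'I_k -> bool) (i : 'I_k) : bool :=
  [forall j : 'I_k, (j < i) ==> z j].

Lemma low_lift k (z : 'I_k.+1 -> bool) (i : 'I_k) :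
  low z (lift ord0 i) = z ord0 && low (fun j => z (lift ord0 j)) i.
Proof.
apply/forallP/andP => [h|[h0 /forallP h] j].
  split; first by have := h ord0; rewrite lift0.
  by apply/forallP => j; have := h (lift ord0 j); rewrite !lift0 ltnS.
case: (unliftP ord0 j) => [j' ->|->]; last by rewrite h0 implybT.
by rewrite !lift0 ltnS; apply: h.
Qed.

(** This is subtraction of one in base [W.+1]. Induction on the number of digits strips the lowest
    one: if it is zero, the subtraction is passed on to the others, otherwise the others do not
    change. *)
Lemma odometer k W (f g : 'I_k -> nat) :
  (exists i, f i != 0) ->
  (forall i, g i = if low (fun j => f j == 0) i then
                     (if f i == 0 then W else (f i).-1) else f i) ->
  (\sum_(i < k) g i * W.+1 ^ i).+1 = \sum_(i < k) f i * W.+1 ^ i.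
Proof.
elim: k f g => [|k IH] f g [i0 fi0] gE; first by case: i0 fi0.
have S (h : 'I_k.+1 -> nat) : \sum_(i < k.+1) h i * W.+1 ^ i =
    h ord0 + W.+1 * \sum_(i < k) h (lift ord0 i) * W.+1 ^ i.
  rewrite big_ord_recl muln1 big_distrr /=; congr addn.
  by apply: eq_bigr => i _; rewrite /bump add1n expnS mulnCA.
rewrite !S gE.
have -> : low (fun j => f j == 0) ord0 by apply/forallP.
have [f0|f0] := eqVneq (f ord0) 0.
  rewrite f0 -addSn -mulnS add0n; congr muln.
  rewrite -(IH (fun i => f (lift ord0 i)) (fun i => g (lift ord0 i))) //.
  by case: (unliftP ord0 i0) fi0 => [j -> h|->]; [exists j|rewrite f0].
  by move=> i; rewrite gE low_lift f0.
rewrite -addSn prednK ?lt0n //; congr (_ + _ * _).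
by apply: eq_bigr => i _; rewrite gE low_lift (negbTE f0).
Qed.

Section Clock.
Variables (M : smachine) (k : nat).
Notation S := (bool + saux M)%type.

(* Digit [i] of the odometer is the height of stack [(i, d i)].  When a digit
   underflows, the two stacks [(i, _)] exchange their roles, which resets the
   digit in one step. *)
Definition clock_state : finType := (sstate M * {ffun 'I_k -> bool})%type.
Definition clock_stack : finType := (stack M + 'I_k * bool)%type.

Definition clock_load (v : clock_stack) (o : option bool) : option S :=
  if v is inl v then sload v o else Some (inl true).

Definition zero (d : 'I_k -> bool) (t : clock_stack -> option S) (i : 'I_k) : bool :=
  t (inr (i, d i)) == None.

Definition tick (d : {ffun 'I_k -> bool}) (t : clock_stack -> option S)
    (d' : {ffun 'I_k -> bool}) (u : clock_stack -> op S) : Prop :=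
  [/\ exists i, ~~ zero d t i,
      d' = [ffun i => d i (+) (low (zero d t) i && zero d t i)] &
      forall i b, u (inr (i, b)) =
        if low (zero d t) i && ~~ zero d t i then
          (if b == d i then Pop else push (inl true) (t (inr (i, b))))
        else keep (t (inr (i, b)))].

Definition clock_delta (q : clock_state) (t : clock_stack -> option S)
    (q' : clock_state) (u : clock_stack -> op S) : Prop :=
  sdelta q.1 (fun v => t (inl v)) q'.1 (fun v => u (inl v)) /\ tick q.2 t q'.2 u.

Definition clocked : smachine :=
  @SMachine clock_state clock_stack (saux M) (sstart M, [ffun=> false])
    (fun q => sfinal q.1) clock_load clock_delta.

Definition unclock (c : sstate clocked * store clocked) : sstate M * store M :=
  (c.1.1, fun v => c.2 (inl v)).

(** A letter popped from the active stack of a digit is pushed on the other one, so the two heights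
    keep a constant sum, which is the largest digit. An exchange at height zero therefore resets the
    digit to [W]. *)
Definition balanced W (c : sstate clocked * store clocked) : Prop :=
  forall i, size (c.2 (inr (i, true))) + size (c.2 (inr (i, false))) = W.

Definition time_left W (c : sstate clocked * store clocked) : nat :=
  \sum_(i < k) size (c.2 (inr (i, c.1.2 i))) * W.+1 ^ i.

Lemma zeroE (c : sstate clocked * store clocked) i :
  zero c.1.2 (tops c.2) i = (size (c.2 (inr (i, c.1.2 i))) == 0).
Proof. by rewrite /zero /tops; case: (c.2 _). Qed.

Lemma tick_time W c (c' : sstate clocked * store clocked) u :
  balanced W c -> tick c.1.2 (tops c.2) c'.1.2 u ->
  c'.2 = (fun v => act (u v) (c.2 v)) ->
  balanced W c' /\ (time_left W c').+1 = time_left W c.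
Proof.
move=> bal [[i0 hi0] dE uE] stE.
set z := zero c.1.2 (tops c.2) in hi0 dE uE.
have sz i b : size (c'.2 (inr (i, b))) =
    if low z i && ~~ z i then
      (if b == c.1.2 i then (size (c.2 (inr (i, b)))).-1 else (size (c.2 (inr (i, b)))).+1)
    else size (c.2 (inr (i, b))).
  rewrite stE uE; case: ifP => _; last by rewrite act_keep.
  by case: ifP => _; rewrite ?act_push //= size_behead.
have z0 i : ~~ z i -> 0 < size (c.2 (inr (i, c.1.2 i))).
  by rewrite /z zeroE lt0n.
split=> [i|].
  rewrite !sz; have := bal i; case: ifP => // /andP [_ /z0].
  by case: (c.1.2 i) => /=; lia.
rewrite /time_left.
apply: (@odometer _ _ (fun i => size (c.2 (inr (i, c.1.2 i))))).
  by exists i0; rewrite -zeroE.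
move=> i; rewrite -zeroE -/(z i).
have -> : low (fun j => size (c.2 (inr (j, c.1.2 j))) == 0) i = low z i.
  by apply: eq_forallb => j; rewrite /z zeroE.
rewrite sz dE ffunE; case: (low z i) => /=; last by rewrite addbF.
have [zi|zi] := boolP (z i) => /=; last by rewrite addbF eqxx.
rewrite addbT; have := bal i; move: zi; rewrite /z zeroE.
by case: (c.1.2 i) => /eqP /=; lia.
Qed.

Lemma tick_exists W c : 0 < time_left W c ->
  forall u0 : stack M -> op S, exists d' u,
   tick c.1.2 (tops c.2) d' u /\ (fun v => u (inl v)) = u0.
Proof.
move=> pos u0.
set z := zero c.1.2 (tops c.2).
exists [ffun i => c.1.2 i (+) (low z i && z i)].
exists (fun v => match v with inl v => u0 v | inr (i, b) =>
   if low z i && ~~ z i then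
          (if b == c.1.2 i then Pop else push (inl true) (tops c.2 (inr (i, b))))
        else keep (tops c.2 (inr (i, b))) end).
split=> //; split=> //.
apply/not_existsP => h; move: pos; rewrite lt0n => /eqP; apply.
rewrite /time_left big1 // => i _.
by have /negP/negPn := h i; rewrite zeroE => /eqP ->.
Qed.

Lemma clocked_run W n c c' : balanced W c -> ssteps n c c' ->
  n + time_left W c' = time_left W c /\ ssteps n (unclock c) (unclock c').
Proof.
elim: n c => [|n IH] c bal; first by move=> ->.
case=> d [u [ud ut] dE] /IH h.
have [bal' <-] := tick_time bal ut dE.
have [<- st] := h bal'; split=> //.
by exists (unclock d) => //; exists (fun v => u (inl v)) => //=; rewrite dE.
Qed.

Lemma run_clocked W n c c1 : balanced W c -> n <= time_left W c ->
  ssteps n (unclock c) c1 -> exists2 c', ssteps n c c' & unclock c' = c1.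
Proof.
elim: n c => [|n IH] c bal le /=; first by move=> <-; exists c.
case=> -[q st] [u0 ud /= stE] h.
have [d' [u [ut uE]]] := tick_exists (leq_ltn_trans (leq0n n) le) u0.
pose c2 : sstate clocked * store clocked :=
  ((q, d'), fun v => act (u v) (c.2 v)).
have [bal' te] := @tick_time W c c2 u bal ut erefl.
have [||c' h1 h2] := IH c2 bal'; first by rewrite -ltnS te.
  by rewrite /unclock /=; move: h; rewrite stE -uE.
by exists c' => //; exists c2 => //; exists u => //; split=> //=; rewrite uE.
Qed.

Lemma unclock_init x : unclock (sinit clocked x) = sinit M x.
Proof.
rewrite /unclock /sinit /=; congr pair.
suff h (st : store clocked) (st' : store M) : (fun v => st (inl v)) = st' ->
  (fun v => foldl (fun st b => load (Some b) st) st x (inl v)) =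
  foldl (fun st b => load (Some b) st) st' x.
  by apply/funext => v; rewrite /load /= -(h (fun=> [::]) (fun=> [::])).
elim: x st st' => [|b x IH] st st' //= <-.
by apply: IH; apply/funext => v.
Qed.

Lemma clock_init x i b : size ((sinit clocked x).2 (inr (i, b))) = (size x).+1.
Proof.
rewrite /sinit /= /load /=; congr (_.+1).
suff h (st : store clocked) :
    size (foldl (fun st b => load (Some b) st) st x (inr (i, b))) =
    size x + size (st (inr (i, b))) by rewrite h addn0.
by elim: x st => [|a x IH] st //=; rewrite IH /load /= addnS.
Qed.

Lemma balanced_init x : balanced ((size x).+1 + (size x).+1) (sinit clocked x).
Proof. by move=> i; rewrite !clock_init. Qed.

Lemma time_left_init W x : time_left W (sinit clocked x) =
  \sum_(i < k) (size x).+1 * W.+1 ^ i.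
Proof. by apply: eq_bigr => i _; rewrite clock_init. Qed.
End Clock.

(** A time bound is asked only of one accepting path for each member of [A]; the clock cuts off all
    other paths of [M], however long. *)
Lemma NP_stack (A : language) (M : smachine) (k : nat) :
  (forall x, A x -> exists2 n, n <= (size x + 2) ^ k & sacc n (sinit M x)) ->
  (forall x n, sacc n (sinit M x) -> A x) -> NP A.
Proof.
move=> complete sound.
have -> : A = [set x | exists n, sacc n (sinit (clocked M k.+1) x)].
  apply/seteqP; split=> x /=.
    move=> /complete [n le [c]]; rewrite -(unclock_init M k.+1) => run f.
    have [|c' h1 h2] := run_clocked (@balanced_init M k.+1 x) _ run.
      (* The highest of the [k.+1] digits alone is worth enough: its weight is a [k]-th power with
         base above [size x + 2]. *)
      rewrite time_left_init big_ord_recr /=.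
      apply: (leq_trans le); apply: leq_trans (leq_addl _ _).
      apply: leq_trans (leq_pmull _ _) => //.
      by case: (k) => // k'; rewrite leq_exp2r //; lia.
    by exists n, c' => //; move: f; rewrite -h2.
  move=> [n [c /(clocked_run (@balanced_init M k.+1 x)) [_ h] f]].
  by apply: (sound _ n); exists (unclock c); rewrite -?(unclock_init M k.+1).
apply: (@compile_NP _ (\sum_(i < k.+1) ('X + 1%:P) * ('X + 1%:P + ('X + 1%:P) + 1%:P) ^+ i)%R).
move=> x n c /(clocked_run (@balanced_init _ _ _)) [+ _].
rewrite time_left_init horner_sum => h.
apply: (@leq_trans (\sum_(i < k.+1) (size x).+1 * ((size x).+1 + (size x).+1).+1 ^ i)).
  by rewrite -h leq_addr.
apply: leq_sum => i _.
rewrite hornerM horner_exp !hornerD hornerX !hornerC !natrE !addn1.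
by [].
Qed.

(** * A stack program simulating an oracle machine *)

(** A deterministic stretch from [c] to [c'], seen through acceptance only. The first half serves
    soundness, proved by induction on the time to acceptance, and the second counts time for
    completeness. *)
Definition lead (M : smachine) (n : nat) (c c' : sstate M * store M) : Prop :=
  (forall k, sacc k c -> exists2 k', k' <= k & sacc k' c') /\
  (forall k, sacc k c' -> exists2 k', k' <= n + k & sacc k' c).

Lemma lead_refl M n (c : sstate M * store M) : lead n c c.
Proof. by split=> k h; exists k; rewrite ?leq_addl. Qed.

Lemma lead_trans M n m p (c c' c'' : sstate M * store M) :
  lead n c c' -> lead m c' c'' -> n + m <= p -> lead p c c''.
Proof.
move=> [h1 h2] [h3 h4] le; split=> k.
  by move=> /h1 [k1 le1 /h3 [k2 le2 h]]; exists k2; rewrite ?(leq_trans le2).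
move=> /h4 [k1 le1 /h2 [k2 le2 h]]; exists k2 => //.
by rewrite (leq_trans le2) // (leq_trans _ (leq_add le (leqnn k))) // -addnA leq_add2l.
Qed.

Lemma sacc_step M k (c : sstate M * store M) : ~~ sfinal c.1 -> sacc k c ->
  exists k' c', [/\ k = k'.+1, sstep c c' & sacc k' c'].
Proof.
move=> nf [c' + f]; case: k => [|k] /=; first by move=> cE; rewrite cE f in nf.
by case=> d cd dc'; exists k, d; split=> //; exists c'.
Qed.

Lemma lead_step M (c c1 : sstate M * store M) : ~~ sfinal c.1 ->
  (forall c', sstep c c' <-> c' = c1) -> lead 1 c c1.
Proof.
move=> nf h; split=> k.
  by move=> /(sacc_step nf) [k' [c' [-> /h ->]]] a; exists k'.
move=> [c' h1 h2]; exists k.+1; rewrite ?add1n //.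
by exists c' => //; exists c1 => //; apply/h.
Qed.

Fixpoint succ_word (x : word) : word :=
  match x with
  | [::] => [:: false]
  | false :: x => true :: x
  | true :: x => false :: succ_word x
  end.

(* [RO]: the pending query, last letter on top; [RT]: the list of the words that
   the simulated oracle contains, each stored like [RO] and followed by [hash];
   [RX]: the word whose answer is being computed; [RI]: the input, reversed;
   [RF]: one symbol per computed answer, the fuel of the last simulation; the
   other registers are scratch space. *)
Variant reg : Type := RO | RO2 | RT | RT2 | RX | RX2 | RI | RF.

Definition reg_code r := match r with
  | RO => (true, true, true) | RO2 => (true, true, false)
  | RT => (true, false, true) | RT2 => (true, false, false)
  | RX => (false, true, true) | RX2 => (false, true, false)
  | RI => (false, false, true) | RF => (false, false, false) end.

Definition reg_decode c := match c with
  | (true, true, true) => RO | (true, true, false) => RO2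
  | (true, false, true) => RT | (true, false, false) => RT2
  | (false, true, true) => RX | (false, true, false) => RX2
  | (false, false, true) => RI | (false, false, false) => RF end.

Lemma reg_codeK : cancel reg_code reg_decode.
Proof. by case. Qed.

HB.instance Definition _ := Countable.copy reg (can_type reg_codeK).
HB.instance Definition _ : isFinite reg := CanIsFinite reg_codeK.

(* [Loop] chooses between computing the next answer ([Inc], [IncB], [IncE] and
   [Copy] prepare the next word, [Sim false] runs [N] on it, [Clear] erases the
   tapes) and running [N] on the input ([Fin], [Sim true]).  A query is looked
   up by [Cmp], [Rest] and [Rew], where [g] records whether an earlier entry
   matched, and [e] whether the current one still does. *)
Variant label (Q : Type) (n : nat) : Type :=
  | Fill of 'I_n.+1 | Loop | Inc of bool | IncB of bool | IncE | Copy
  | Sim of bool & Q | Cmp of bool & Q & Q & bool & bool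
  | Rest of bool & Q & Q & bool & bool | Rew of bool & Q | Clear | Fin | Win.
Arguments Loop {Q n}.
Arguments Inc {Q n} _.
Arguments IncB {Q n} _.
Arguments IncE {Q n}.
Arguments Copy {Q n}.
Arguments Sim {Q n} _ _.
Arguments Cmp {Q n} _ _ _ _ _.
Arguments Rest {Q n} _ _ _ _ _.
Arguments Rew {Q n} _ _.
Arguments Clear {Q n}.
Arguments Fin {Q n}.
Arguments Win {Q n}.

Section Label.
Variables (Q : finType) (n : nat).

Definition label_sum : Type := ('I_n.+1 + (bool * bool + (bool * bool * bool
  + (bool * (bool * Q) + bool * (bool * Q * Q * bool * bool)))))%type.

Definition label_code (l : label Q n) : label_sum :=
  match l with
  | Fill i => inl i
  | Inc c => inr (inl (true, c))
  | IncB c => inr (inl (false, c))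
  | Loop => inr (inr (inl (true, true, true)))
  | IncE => inr (inr (inl (true, true, false)))
  | Copy => inr (inr (inl (true, false, true)))
  | Clear => inr (inr (inl (true, false, false)))
  | Fin => inr (inr (inl (false, true, true)))
  | Win => inr (inr (inl (false, true, false)))
  | Sim f q => inr (inr (inr (inl (true, (f, q)))))
  | Rew f q => inr (inr (inr (inl (false, (f, q)))))
  | Cmp f y z g e => inr (inr (inr (inr (true, (f, y, z, g, e)))))
  | Rest f y z g e => inr (inr (inr (inr (false, (f, y, z, g, e)))))
  end.

Definition label_decode (c : label_sum) : label Q n :=
  match c with
  | inl i => Fill Q i
  | inr (inl (true, c)) => Inc c
  | inr (inl (false, c)) => IncB c
  | inr (inr (inl (true, true, true))) => Loop
  | inr (inr (inl (true, true, false))) => IncE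
  | inr (inr (inl (true, false, true))) => Copy
  | inr (inr (inl (true, false, false))) => Clear
  | inr (inr (inl (false, true, true))) => Fin
  | inr (inr (inl (false, _, _))) => Win
  | inr (inr (inr (inl (true, (f, q))))) => Sim f q
  | inr (inr (inr (inl (false, (f, q))))) => Rew f q
  | inr (inr (inr (inr (true, (f, y, z, g, e))))) => Cmp f y z g e
  | inr (inr (inr (inr (false, (f, y, z, g, e))))) => Rest f y z g e
  end.

Lemma label_codeK : cancel label_code label_decode.
Proof. by case. Qed.

HB.instance Definition _ := Countable.copy (label Q n) (can_type label_codeK).
HB.instance Definition _ : isFinite (label Q n) := CanIsFinite label_codeK.
End Label.

Section Program.
Variables (N : machine) (target : outcome).
Notation S := (bool + option (symbol (aux N)))%type.
(** The finite part of the oracle and the first word are built into the program. The states [Fill]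
    write them symbol by symbol, the flag [true] meaning [RX] and [false] meaning [RT]. *)
Variable consts : seq (bool * S).
Notation Q := (label (state N) (size consts)).
Notation V := ('I_(ntapes N).+1 * bool + reg)%type.

Definition cell (s : symbol (aux N)) : S := inr (Some s).
Definition hash : S := inr None.
(* Stands for the missing answer in the entry under construction; it is not a
   bit, so that this entry matches no query. *)
Definition hole : S := cell None.

Definition content (t : option S) : symbol (aux N) :=
  if t is Some (inr (Some s)) then s else None.

Definition is_bit (t : option S) : option bool :=
  if t is Some (inl b) then Some b else None.

Definition ops (t : V -> option S) (f : 'I_(ntapes N).+1 * bool -> op S)
    (g : reg -> op S) : V -> op S :=
  fun v => match v with inl p => f p | inr r => g r end.

Definition keepN (t : V -> option S) : 'I_(ntapes N).+1 * bool -> op S :=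
  fun p => keep (t (inl p)).

Definition keepR (t : V -> option S) : reg -> op S := fun r => keep (t (inr r)).

Definition push_input (t : V -> option S) (b : bool) :
    'I_(ntapes N).+1 * bool -> op S :=
  fun p => if p == (ord0, true) then push (cell (Some (inl b))) (t (inl p))
           else keep (t (inl p)).

(** [Inc c] adds the carry [c], least significant bit first. Each new bit goes to [RX2] and to [RT],
    and [IncB] adds a zero witness bit to [RT], so the entry of the new word is built during the
    addition; [Inc false] and [IncE] close it with the last witness bit and a [hole]. [Cmp] moves
    what it compares to [RO2] and [RT2], from where [Rest] and [Rew] bring it back. *)
Definition det_delta (q : Q) (t : V -> option S) : option (Q * (V -> op S)) :=
  let pushR r a := push a (t (inr r)) in
  let K := keepR t in
  let idle := ops t (keepN t) K in
  match q with
  | Fill j =>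
      if onth consts j is Some (b, a) then
        Some (Fill _ (inord j.+1), ops t (keepN t) (fun r => match r with
          | RX => if b then pushR RX a else K RX
          | RT => if b then K RT else pushR RT a
          | r => K r end))
      else Some (Loop, idle)
  | Inc c =>
      match t (inr RX) with
      | Some (inl b) =>
          Some (IncB (c && b), ops t (keepN t) (fun r => match r with
          | RX => Pop
          | RX2 => pushR RX2 (inl (b (+) c))
          | RT => pushR RT (inl (b (+) c))
          | r => K r end))
      | Some _ => None
      | None =>
         if c then Some (IncB false, ops t (keepN t) (fun r => match r with
          | RX2 => pushR RX2 (inl false)
          | RT => pushR RT (inl false)
          | r => K r end))
         else Some (IncE, ops t (keepN t) (fun r => match r with
          | RT => pushR RT (inl false)
          | r => K r end))
      end
  | IncB c => Some (Inc c, ops t (keepN t) (fun r => match r with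
          | RT => pushR RT (inl false)
          | r => K r end))
  | IncE => Some (Copy, ops t (keepN t) (fun r => match r with
          | RT => pushR RT hole
          | r => K r end))
  | Copy =>
      if is_bit (t (inr RX2)) is Some b then
        Some (Copy, ops t (push_input t b) (fun r => match r with
          | RX2 => Pop
          | RX => pushR RX (inl b)
          | r => K r end))
      else Some (Sim false (start N), idle)
  | Fin =>
      if is_bit (t (inr RI)) is Some b then
        Some (Fin, ops t (push_input t b) (fun r => match r with
          | RI => Pop
          | r => K r end))
      else Some (Sim true (start N), idle)
  | Cmp f y n g e =>
      match t (inr RT), t (inr RO) with
      | None, None => Some (Rew f (if g then y else n), idle)
      | None, Some _ => Some (Cmp f y n g e, ops t (keepN t) (fun r => match r with
          | RO => Pop
          | r => K r end))
      | Some (inr None), None =>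
          Some (Rest f y n g e, ops t (keepN t) (fun r => match r with
          | RT => Pop
          | RT2 => pushR RT2 hash
          | r => K r end))
      | Some (inr None), Some b =>
          Some (Cmp f y n g false, ops t (keepN t) (fun r => match r with
          | RO => Pop
          | RO2 => pushR RO2 b
          | r => K r end))
      | Some a, None =>
          Some (Cmp f y n g false, ops t (keepN t) (fun r => match r with
          | RT => Pop
          | RT2 => pushR RT2 a
          | r => K r end))
      | Some a, Some b =>
          Some (Cmp f y n g (e && (a == b)), ops t (keepN t) (fun r => match r with
          | RT => Pop
          | RT2 => pushR RT2 a
          | RO => Pop
          | RO2 => pushR RO2 b
          | r => K r end))
      end
  | Rest f y n g e =>
      if t (inr RO2) is Some b then
        Some (Rest f y n g e, ops t (keepN t) (fun r => match r with
          | RO2 => Pop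
          | RO => pushR RO b
          | r => K r end))
      else Some (Cmp f y n (g || e) true, idle)
  | Rew f q =>
      if t (inr RT2) is Some a then
        Some (Rew f q, ops t (keepN t) (fun r => match r with
          | RT2 => Pop
          | RT => pushR RT a
          | r => K r end))
      else Some (Sim f q, idle)
  | Clear =>
      if [forall p, t (inl p) == None] && (t (inr RO) == None) then
        Some (Loop, idle)
      else Some (Clear, ops t (fun=> Pop) (fun r => match r with
          | RO => Pop
          | r => K r end))
  | Loop | Sim _ _ | Win => None
  end.

Definition tape_op (t : V -> option S) (a : 'I_(ntapes N).+1 -> symbol (aux N) * move)
    (p : 'I_(ntapes N).+1 * bool) : op S :=
  let: (i, rgt) := p in
  match (a i).2, rgt with
  | MoveLeft, false => Pop
  | MoveLeft, true => Put2 (cell (content (t (inl (i, false))))) (cell (a i).1)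
  | Stay, false => keep (t (inl p))
  | Stay, true => Put (cell (a i).1)
  | MoveRight, false => push (cell (a i).1) (t (inl p))
  | MoveRight, true => Pop
  end.

Definition fuel_op (f : bool) (t : V -> option S) : op S :=
  if f then Pop else keepR t RF.

(** The verdict of a run for the table replaces the [hole] on top of [RT] and so completes the
    entry; when such a run ends in [Unk], the path dies. Only the last run, with [f] true, burns a
    symbol of [RF] for each step of [N]. *)
Definition prog_delta (q : Q) (t : V -> option S) (q' : Q) (u : V -> op S) : Prop :=
  match q with
  | Loop =>
      q' = Inc true /\ u = ops t (keepN t) (fun r => match r with
          | RT => push hash (t (inr RT))
          | RF => push hash (t (inr RF))
          | r => keepR t r end) \/
      q' = Fin /\ u = ops t (keepN t) (keepR t)
  | Sim f q =>
      match kind q with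
      | Halt o =>
          if f then [/\ o = target, q' = Win & u = ops t (keepN t) (keepR t)]
          else exists b : bool, [/\ o = (if b then Acc else Rej), q' = Clear &
            u = ops t (keepN t) (fun r => match r with
              | RT => Put (inl b)
              | r => keepR t r end)]
      | Ask y n =>
          [/\ f -> t (inr RF) != None, q' = Cmp f y n false true &
            u = ops t (keepN t) (fun r => match r with
              | RF => fuel_op f t
              | r => keepR t r end)]
      | Compute =>
          exists2 a, a \in trans q [ffun i => content (t (inl (i, true)))] &
          [/\ f -> t (inr RF) != None, q' = Sim f a.1.1 &
            u = ops t (tape_op t a.1.2) (fun r => match r with
              | RF => fuel_op f t
              | RO => if a.2 is Some b then push (inl b) (t (inr RO)) else keepR t RO
              | r => keepR t r end)]
      end
  | q => det_delta q t = Some (q', u)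
  end.

Definition prog_load (v : V) (o : option bool) : option S :=
  if v is inr RI then omap inl o else None.

Definition prog : smachine :=
  @SMachine Q V (option (symbol (aux N))) (Fill _ ord0) (fun q => q == Win) prog_load prog_delta.

Definition mkstore (tp : 'I_(ntapes N).+1 -> tape (aux N)) (o o2 t t2 x x2 i f : seq S) :
    store prog :=
  fun v => match v with
  | inl (k, rgt) => [seq cell s | s <- if rgt then (tp k).2 else (tp k).1]
  | inr RO => o | inr RO2 => o2 | inr RT => t | inr RT2 => t2
  | inr RX => x | inr RX2 => x2 | inr RI => i | inr RF => f
  end.

Definition input_tapes (x : word) : {ffun 'I_(ntapes N).+1 -> tape (aux N)} :=
  ctapes (init N x).

Lemma lead_det (q q1 : Q) (u1 : V -> op S) (st st1 : store prog) :
  det_delta q (tops st) = Some (q1, u1) -> (forall v, act (u1 v) (st v) = st1 v) ->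
  lead 1 ((q, st) : sstate prog * store prog) (q1, st1).
Proof.
move=> h stE.
have hd q' u : prog_delta q (tops st) q' u <-> det_delta q (tops st) = Some (q', u).
  by case: (q) h.
apply: lead_step; first by case: (q) h.
case=> q' st'; split=> [[u /= /hd]|[-> ->]].
  by rewrite h => -[<- <-] ->; congr pair; apply/funext.
by exists u1; [apply/hd | apply/funext].
Qed.

Ltac store_eq := by move=> [[k []]|[]] //=; rewrite /keepN /keepR ?act_keep ?act_push.
Ltac det := apply: lead_det; [reflexivity | store_eq].

(** * Lookup of a query in the table *)

Lemma rest_lead f y n g e tp o o2 t t2 x x2 i fl :
  lead (size o2).+1 ((Rest f y n g e, mkstore tp o o2 t t2 x x2 i fl) : sstate prog * store prog)
    (Cmp f y n (g || e) true, mkstore tp (rev o2 ++ o) [::] t t2 x x2 i fl).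
Proof.
elim: o2 o => [|b o2 IH] o /=; first by det.
apply: (@lead_trans prog 1 (size o2).+1 _ _
  (Rest f y n g e, mkstore tp (b :: o) o2 t t2 x x2 i fl)) => //; first by det.
by rewrite rev_cons cat_rcons; apply: IH.
Qed.

Lemma rew_lead f q tp o o2 t t2 x x2 i fl :
  lead (size t2).+1 ((Rew f q, mkstore tp o o2 t t2 x x2 i fl) : sstate prog * store prog)
    (Sim f q, mkstore tp o o2 (rev t2 ++ t) [::] x x2 i fl).
Proof.
elim: t2 t => [|b t2 IH] t /=; first by det.
apply: (@lead_trans prog 1 (size t2).+1 _ _
  (Rew f q, mkstore tp o o2 (b :: t) t2 x x2 i fl)) => //; first by det.
by rewrite rev_cons cat_rcons; apply: IH.
Qed.

Lemma cmp_end_lead f y n g e tp o o2 t2 x x2 i fl :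
  lead (size o).+1 ((Cmp f y n g e, mkstore tp o o2 [::] t2 x x2 i fl) : sstate prog * store prog)
    (Rew f (if g then y else n), mkstore tp [::] o2 [::] t2 x x2 i fl).
Proof.
elim: o => [|b o IH] /=; first by det.
apply: (@lead_trans prog 1 (size o).+1 _ _
  (Cmp f y n g e, mkstore tp o o2 [::] t2 x x2 i fl)) => //; by det.
Qed.

Lemma cmp_hash_lead f y n g e tp o o2 t t2 x x2 i fl :
  lead (size o).+1 ((Cmp f y n g e, mkstore tp o o2 (hash :: t) t2 x x2 i fl) : sstate prog * store prog)
    (Rest f y n g (e && (o == [::])), mkstore tp [::] (rev o ++ o2) t (hash :: t2) x x2 i fl).
Proof.
elim: o o2 e => [|b o IH] o2 e /=; first by rewrite andbT; det.
apply: (@lead_trans prog 1 (size o).+1 _ _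
  (Cmp f y n g false, mkstore tp o (b :: o2) (hash :: t) t2 x x2 i fl)) => //; first by det.
by rewrite rev_cons cat_rcons andbF; apply: IH.
Qed.

Lemma cmp_entry_lead f y n g e tp en o o2 t t2 x x2 i fl : hash \notin en ->
  lead (size en + size o).+1
    ((Cmp f y n g e, mkstore tp o o2 (rcons en hash ++ t) t2 x x2 i fl) : sstate prog * store prog)
    (Rest f y n g (e && (en == o)),
     mkstore tp [::] (rev o ++ o2) t (rev (rcons en hash) ++ t2) x x2 i fl).
Proof.
elim: en o o2 t2 e => [|a en IH] o o2 t2 e.
  by move=> _; rewrite eq_sym; apply: cmp_hash_lead.
rewrite inE negb_or => /andP [ah nh]; rewrite rcons_cons rev_cons cat_rcons cat_cons.
case: o => [|b o].
  apply: (@lead_trans prog 1 (size en).+1 _ _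
    (Cmp f y n g false, mkstore tp [::] o2 (rcons en hash ++ t) (a :: t2) x x2 i fl)).
  - by case: a ah => [a|[a|]] // _; det.
  - by rewrite andbF -[false]/(false && (en == [::])) -(addn0 (size en)); apply: IH.
  - by rewrite /= addn0.
apply: (@lead_trans prog 1 (size en + size o).+1 _ _
  (Cmp f y n g (e && (a == b)),
   mkstore tp o (b :: o2) (rcons en hash ++ t) (a :: t2) x x2 i fl)).
- by case: a ah => [a|[a|]] // _; det.
- by rewrite eqseq_cons andbA rev_cons (cat_rcons b); apply: IH.
- by rewrite /=; lia.
Qed.

Definition table (es : seq (seq S)) : seq S := flatten [seq rcons e hash | e <- es].

Definition wf_entries (es : seq (seq S)) : bool := all (fun e => hash \notin e) es.

Lemma cmp_lead f y n g tp es o t2 x x2 i fl : wf_entries es ->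
  lead (size (table es) * (3 * size o + 3) + (size o).+1)
    ((Cmp f y n g true, mkstore tp o [::] (table es) t2 x x2 i fl) : sstate prog * store prog)
    (Rew f (if g || (o \in es) then y else n),
     mkstore tp [::] [::] [::] (rev (table es) ++ t2) x x2 i fl).
Proof.
elim: es g t2 => [|e es IH] g t2 /= => [_|/andP [he hes]].
  by rewrite orbF; apply: cmp_end_lead.
rewrite /table /= -/(table es) rev_cat -catA.
have h1 := cmp_entry_lead f y n g true tp o [::] (table es) t2 x x2 i fl he.
have h2 := rest_lead f y n g (e == o) tp [::] (rev o) (table es)
  (rev (rcons e hash) ++ t2) x x2 i fl.
have h3 := IH (g || (e == o)) (rev (rcons e hash) ++ t2) hes.
rewrite revK cats0 in h2; rewrite cats0 in h1.
rewrite inE orbA [o == e]eq_sym.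
apply: lead_trans h1 (lead_trans h2 h3 (leqnn _)) _.
rewrite size_rev size_cat size_rcons.
(* Comparing one entry takes at most [size e + size o + 1] steps and restoring the query
   [size o + 1]; as an entry with its [hash] occupies [size e + 1] symbols, the product form absorbs
   both. *)
by move: (size e) (size o) (size (table es)) => a b c; nia.
Qed.

Definition query_cost (es : seq (seq S)) (n : nat) : nat :=
  size (table es) * (3 * n + 4) + n + 3.

Lemma query_lead f y n tp es o x x2 i fl : wf_entries es ->
  lead (query_cost es (size o))
    ((Cmp f y n false true, mkstore tp o [::] (table es) [::] x x2 i fl) : sstate prog * store prog)
    (Sim f (if o \in es then y else n), mkstore tp [::] [::] (table es) [::] x x2 i fl).
Proof.
move=> he; have h1 := cmp_lead f y n false tp o [::] x x2 i fl he.
have h2 := rew_lead f (if o \in es then y else n) tp [::] [::] [::]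
  (rev (table es)) x x2 i fl.
rewrite !cats0 in h1 h2; rewrite revK in h2.
by apply: lead_trans h1 h2 _; rewrite /query_cost size_rev;
  move: (size o) (size (table es)) => a b; nia.
Qed.

Definition table_lang (es : seq (seq S)) : language :=
  [set w | [seq inl b | b <- rev w] \in es].

Lemma content_cell (s : seq (symbol (aux N))) :
  content (ohead [seq cell a | a <- s]) = head None s.
Proof. by case: s. Qed.

Lemma tape_op_write st (tp : {ffun 'I_(ntapes N).+1 -> tape (aux N)}) a p :
  (forall k b, st (inl (k, b)) = [seq cell s | s <- if b then (tp k).2 else (tp k).1]) ->
  act (tape_op (fun v => ohead (st v)) a p) (st (inl p)) =
  [seq cell s | s <- if p.2 then (write_move (tp p.1) (a p.1)).2
                     else (write_move (tp p.1) (a p.1)).1].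
Proof.
case: p => k b h; rewrite /tape_op /write_move /= !h.
case: (tp k) => l r; case: (a k) => s [] /=; case: b; rewrite ?act_keep ?act_push //=.
- by rewrite behead_map content_cell.
- by rewrite behead_map.
- by rewrite behead_map.
- by rewrite behead_map.
Qed.

(** * Runs of the oracle machine inside the program *)

Definition sim_config f (c : config N) es x i fl : sstate prog * store prog :=
  (Sim f (cstate c),
   mkstore (ctapes c) [seq inl b | b <- rev (coracle c)] [::] (table es) [::] x [::] i fl).

Lemma sim_sacc k f c es x i fl : sacc k (sim_config f c es x i fl) ->
  exists k' c', [/\ k = k'.+1, sstep (sim_config f c es x i fl) c' & sacc k' c'].
Proof. exact: sacc_step. Qed.

Lemma sim_compute f c es x i fl d : kind (cstate c) = Compute ->
  sstep (sim_config f c es x i fl) d <->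
  exists2 c', step (table_lang es) c c' & (f -> 0 < size fl) /\
    d = sim_config f c' es x i (if f then behead fl else fl).
Proof.
move=> kc; rewrite /sstep /sim_config /= kc /step kc.
have rE : [ffun k => content (tops (sim_config f c es x i fl).2 (inl (k, true)))] =
    [ffun k => read (ctapes c k)].
  by apply/ffunP => k; rewrite !ffunE /tops /= content_cell.
have flE : (f -> tops (sim_config f c es x i fl).2 (inr RF) != None) <-> (f -> 0 < size fl).
  by rewrite /tops /=; case: (fl).
have stE (m : 'I_(ntapes N).+1 -> symbol (aux N) * move) (o : option bool) :
  (fun v => act (ops (tops (sim_config f c es x i fl).2)
   (tape_op (tops (sim_config f c es x i fl).2) m) (fun r => match r with
              | RF => fuel_op f (tops (sim_config f c es x i fl).2)
              | RO =>
                  if o is Some b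
                  then push (inl b) (tops (sim_config f c es x i fl).2 (inr RO))
                  else keepR (tops (sim_config f c es x i fl).2) RO
              | r => keepR (tops (sim_config f c es x i fl).2) r end) v)
     ((sim_config f c es x i fl).2 v)) =
   mkstore [ffun i => write_move (ctapes c i) (m i)]
     [seq inl b | b <- rev (append (coracle c) o)] [::] (table es) [::] x [::] i
     (if f then behead fl else fl).
  apply/funext => -[[k b]|[]] /=; rewrite /keepR ?act_keep //=.
  - rewrite ffunE; exact: (@tape_op_write (sim_config f c es x i fl).2 (ctapes c) m (k, b) (fun _ _ => erefl)).
  - by case: (o) => [b|]; rewrite ?act_push ?act_keep //= rev_rcons.
  - by rewrite /fuel_op; case: (f) => //; rewrite /keepR act_keep.
split.
  move=> [u [a ha [h1 h2 ->]] h3].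
  exists (Config a.1.1 [ffun i => write_move (ctapes c i) (a.1.2 i)]
               (append (coracle c) a.2)).
    by exists a => //; rewrite -rE.
  split; first exact/flE.
  by case: d h2 h3 => q st /= -> ->; rewrite -(stE a.1.2 a.2).
move=> [c' [a ha ->] [h1 ->]].
eexists; first by exists a; [rewrite rE|split; [apply/flE| reflexivity|reflexivity]].
by rewrite /= -(stE a.1.2 a.2).
Qed.


Lemma sim_ask f c es x i fl y n d : kind (cstate c) = Ask y n ->
  sstep (sim_config f c es x i fl) d <->
  (f -> 0 < size fl) /\
  d = (Cmp f y n false true,
       mkstore (ctapes c) [seq inl b | b <- rev (coracle c)] [::] (table es) [::] x [::] i
       (if f then behead fl else fl)).
Proof.
move=> kc; rewrite /sstep /sim_config /= kc.
have flE : (f -> tops (sim_config f c es x i fl).2 (inr RF) != None) <-> (f -> 0 < size fl).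
  by rewrite /tops /=; case: (fl).
have stE : (fun v => act (ops (tops (sim_config f c es x i fl).2)
   (keepN (tops (sim_config f c es x i fl).2)) (fun r => match r with
              | RF => fuel_op f (tops (sim_config f c es x i fl).2)
              | r => keepR (tops (sim_config f c es x i fl).2) r end) v)
     ((sim_config f c es x i fl).2 v)) =
   mkstore (ctapes c) [seq inl b | b <- rev (coracle c)] [::] (table es) [::] x [::] i
     (if f then behead fl else fl).
  apply/funext => -[[k b]|[]] /=; rewrite /keepN /keepR ?act_keep //=.
  by rewrite /fuel_op; case: (f) => //; rewrite /keepR act_keep.
split.
  move=> [u [h1 h2 ->]] h3; split; first exact/flE.
  by case: d h2 h3 => q st /= -> ->; rewrite -stE.
move=> [h1 ->]; eexists; first by split; [apply/flE| reflexivity|reflexivity].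
by rewrite /= -stE.
Qed.

Lemma sim_ask_step f c es x i fl y n : wf_entries es -> kind (cstate c) = Ask y n ->
  exists2 c', forall c'', step (table_lang es) c c'' <-> c'' = c' &
  lead (query_cost es (size (coracle c)))
    ((Cmp f y n false true,
       mkstore (ctapes c) [seq inl b | b <- rev (coracle c)] [::] (table es) [::] x [::] i fl) : sstate prog * store prog)
    (sim_config f c' es x i fl).
Proof.
move=> wf kc.
exists (Config (if [seq inl b | b <- rev (coracle c)] \in es then y else n) (ctapes c) [::]).
  move=> c''; rewrite /step kc /table_lang /=.
  case: ifP => h; split; intuition (try congruence).
have := query_lead f y n (ctapes c) [seq inl b | b <- rev (coracle c)] x [::] i fl wf.
by rewrite size_map size_rev.
Qed.

Definition spend (f : bool) (n : nat) (fl : seq S) : seq S := if f then drop n fl else fl.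

Lemma spendS f n fl : spend f n.+1 fl = spend f n (if f then behead fl else fl).
Proof. by rewrite /spend; case: f => //; rewrite -drop1 drop_drop addn1. Qed.

Lemma sim_sound k f c es x i fl : wf_entries es -> sacc k (sim_config f c es x i fl) ->
  exists n c' o k',
  [/\ steps (table_lang es) n c c', kind (cstate c') = Halt o, f -> n <= size fl, k' <= k &
      sacc k' (sim_config f c' es x i (spend f n fl))].
Proof.
(* The induction is on the time to acceptance: one query of [N] takes many program steps, and across
   them [lead] says only that this time does not grow. *)
move=> wf; elim/ltn_ind: k c fl => k IH c fl.
case E: (kind (cstate c)) => [|y n|o] h.
- have [k' [d [kE /(sim_compute _ _ _ _ _ _ E) [c' st [hf ->]] h']]] := sim_sacc h.
  have lt : k' < k by rewrite kE.
  have [n [c'' [o [k'' [h1 h2 h3 h4 h5]]]]] := IH k' lt _ _ h'.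
  exists n.+1, c'', o, k''; split=> //; first by exists c'.
  + by move=> fT; move: (h3 fT) (hf fT); rewrite fT size_behead; case: (size fl).
  + by rewrite kE ltnW.
  + by rewrite spendS.
- have [k' [d [kE /(sim_ask _ _ _ _ _ _ E) [hf ->]]]] := sim_sacc h.
  have [c' hc' [hl _]] := sim_ask_step f x i (if f then behead fl else fl) wf E.
  move=> /hl [k1 le1 h'].
  have lt : k1 < k by rewrite kE ltnS.
  have [n1 [c'' [o [k'' [h1 h2 h3 h4 h5]]]]] := IH k1 lt _ _ h'.
  exists n1.+1, c'', o, k''; split=> //; first by exists c' => //; apply/hc'.
  + by move=> fT; move: (h3 fT) (hf fT); rewrite fT size_behead; case: (size fl).
  + by rewrite kE (leq_trans h4) // ltnW.
  + by rewrite spendS.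
- exists 0, c, o, k; split=> //.
  by rewrite /spend; case: (f) h; rewrite ?drop0.
Qed.

Lemma step_coracle D (c c' : config N) : step D c c' ->
  size (coracle c') <= (size (coracle c)).+1.
Proof.
rewrite /step; case: kind => [|y n|//]; last by case=> -[_ ->].
by case=> a _ -> /=; case: a.2 => [b|] /=; rewrite ?size_rcons.
Qed.

Lemma query_cost_le es m n : m <= n -> query_cost es m <= query_cost es n.
Proof.
move=> le; rewrite /query_cost leq_add2r leq_add // leq_mul2l; apply/orP; right.
by rewrite leq_add2r leq_mul2l le orbT.
Qed.

(** The oracle tape grows by at most one letter in a step, so [L] bounds the length of every query,
    and [query_cost es L] the cost of every lookup. *)
Lemma sim_complete L n k (f : bool) c c' es x i fl : wf_entries es ->
  steps (table_lang es) n c c' -> (f -> n <= size fl) -> size (coracle c) + n <= L ->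
  sacc k (sim_config f c' es x i (spend f n fl)) ->
  exists2 k', k' <= n * (query_cost es L).+1 + k & sacc k' (sim_config f c es x i fl).
Proof.
move=> wf; elim: n c fl => [|n IH] c fl.
  move=> /= -> _ _; rewrite /spend => h; exists k => //.
  by case: (f) h; rewrite ?drop0.
case=> d cd dc' hf le; rewrite spendS => h.
have [||k' le' h'] := IH d (if f then behead fl else fl) dc' _ _ h.
- by move=> fT; move: (hf fT); rewrite fT size_behead; case: (size fl).
- by rewrite (leq_trans _ le) // addnS -addSn leq_add2r (step_coracle cd).
case E: (kind (cstate c)) => [|y m|o].
- exists k'.+1; first by rewrite mulSn; lia.
  case: h' => c1 h1 h2; exists c1 => //; eexists; last exact: h1.
  apply/(sim_compute _ _ _ _ _ _ E); exists d => //; split=> // fT.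
  by move: (hf fT); case: (size fl).
- have [c1 hc1 [_ hl]] := sim_ask_step f x i (if f then behead fl else fl) wf E.
  move: cd => /hc1 dE; rewrite dE in h'.
  have [k1 le1 [c2 h1 h2]] := hl _ h'.
  exists k1.+1.
    have := @query_cost_le es (size (coracle c)) L.
    rewrite (leq_trans (leq_addr n.+1 _) le) => /(_ isT).
    by rewrite mulSn; lia.
  exists c2 => //; eexists; last exact: h1.
  by apply/(sim_ask _ _ _ _ _ _ E); split=> // fT; move: (hf fT); case: (size fl).
- by move: cd; rewrite /step E.
Qed.

Lemma sim_halt_final k c es x i fl o : kind (cstate c) = Halt o ->
  sacc k (sim_config true c es x i fl) -> o = target.
Proof.
move=> kc /sim_sacc [k' [d [_ [u]]]].
by rewrite /sim_config /= kc => -[-> _ _].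
Qed.

Lemma sim_halt_target c es x i fl : kind (cstate c) = Halt target ->
  sacc 1 (sim_config true c es x i fl).
Proof.
move=> kc; pose st := (sim_config true c es x i fl).2.
exists (Win, fun v => act (ops (tops st) (keepN (tops st)) (keepR (tops st)) v) (st v)) => //.
eexists; last by reflexivity.
by exists (ops (tops st) (keepN (tops st)) (keepR (tops st))) => //; rewrite /= kc.
Qed.

(** * Between two runs: clearing, incrementing, copying *)

Definition outcome_of (b : bool) : outcome := if b then Acc else Rej.

Definition clear_config (c : config N) t x i fl : sstate prog * store prog :=
  (Clear, mkstore (ctapes c) [seq inl b | b <- rev (coracle c)] [::] t [::] x [::] i fl).

Lemma sim_halt c es x i fl o d : kind (cstate c) = Halt o ->
  sstep (sim_config false c es x i fl) d <->
  exists2 b, o = outcome_of b & d = clear_config c (inl b :: behead (table es)) x i fl.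
Proof.
move=> kc; rewrite /sstep /sim_config /= kc.
set st := mkstore _ _ _ _ _ _ _ _ _.
have stE b : (fun v => act (ops (tops st) (keepN (tops st)) (fun r => match r with
              | RT => Put (inl b)
              | r => keepR (tops st) r end) v) (st v)) =
   (clear_config c (inl b :: behead (table es)) x i fl).2.
  by apply/funext => -[[k b']|[]] /=; rewrite /keepN /keepR ?act_keep.
split.
  move=> [u [b [-> h1 ->]] h2]; exists b => //.
  by case: d h1 h2 => q st' /= -> ->; rewrite stE.
move=> [b -> ->]; eexists; first by exists b; split; reflexivity.
by rewrite stE.
Qed.

Definition cleared (st : store prog) : bool :=
  [forall p, tops st (inl p) == None] && (tops st (inr RO) == None).

Lemma clear_done (tp : 'I_(ntapes N).+1 -> tape (aux N)) o o2 t t2 x x2 i fl :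
  cleared (mkstore tp o o2 t t2 x x2 i fl) ->
  lead 1 ((Clear, mkstore tp o o2 t t2 x x2 i fl) : sstate prog * store prog)
    (Loop, mkstore (input_tapes [::]) [::] o2 t t2 x x2 i fl).
Proof.
move=> e; apply: lead_det; first by rewrite /det_delta -/(cleared _) e.
case/andP: e => /forallP /= e eo; move=> [p|[]] /=; rewrite /keepN /keepR act_keep //=.
  case: p => k b; have := e (k, b); rewrite /tops /= /input_tapes /= ffunE if_same.
  by case: b; case: (tp k) => [[|? ?] [|? ?]].
by move: eo; rewrite /tops /=; case: (o).
Qed.

Lemma clear_lead B (tp : 'I_(ntapes N).+1 -> tape (aux N)) o o2 t t2 x x2 i fl :
  (forall k, size (tp k).1 <= B /\ size (tp k).2 <= B) -> size o <= B ->
  lead B.+1 ((Clear, mkstore tp o o2 t t2 x x2 i fl) : sstate prog * store prog)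
    (Loop, mkstore (input_tapes [::]) [::] o2 t t2 x x2 i fl).
Proof.
elim: B tp o => [|B IH] tp o htp ho.
  apply: clear_done; apply/andP; split; last by rewrite /tops /=; case: (o) ho.
  apply/forallP => -[k b]; have [] := htp k; rewrite /tops /=.
  by case: b => /=; case: (tp k) => [[|? ?] [|? ?]].
have [/clear_done h|ne] := boolP (cleared (mkstore tp o o2 t t2 x x2 i fl)).
  exact: lead_trans h (lead_refl 0 _) _.
apply: (@lead_trans prog 1 B.+1 _ _
  (Clear, mkstore (fun k => (behead (tp k).1, behead (tp k).2)) (behead o) o2 t t2 x x2 i fl)).
- apply: lead_det; first by rewrite /det_delta -/(cleared _) (negbTE ne).
  move=> [[k b]|[]] //=; rewrite /keepR ?act_keep //.
  by case: b; rewrite behead_map.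
- apply: IH => [k|]; last by rewrite size_behead; case: (size o) ho.
  by have [] := htp k; rewrite !size_behead /=; split; lia.
- by [].
Qed.

Lemma loop_step tp o o2 t t2 x x2 i fl d :
  sstep ((Loop, mkstore tp o o2 t t2 x x2 i fl) : sstate prog * store prog) d <->
  d = (Inc true, mkstore tp o o2 (hash :: t) t2 x x2 i (hash :: fl)) \/
  d = (Fin, mkstore tp o o2 t t2 x x2 i fl).
Proof.
set st := mkstore tp o o2 t t2 x x2 i fl.
have E1 : (fun v => act (ops (tops st) (keepN (tops st)) (fun r => match r with
          | RT => push hash (tops st (inr RT))
          | RF => push hash (tops st (inr RF))
          | r => keepR (tops st) r end) v) (st v)) =
          mkstore tp o o2 (hash :: t) t2 x x2 i (hash :: fl).
  by apply/funext; store_eq.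
have E2 : (fun v => act (ops (tops st) (keepN (tops st)) (keepR (tops st)) v) (st v)) = st.
  by apply/funext; store_eq.
split.
  case: d => q st' [u /= [[-> ->]|[-> ->]] ->]; first by left; rewrite E1.
  by right; rewrite E2.
case=> ->; eexists.
- by left; split; reflexivity.
- by rewrite E1.
- by right; split; reflexivity.
- by rewrite E2.
Qed.

Definition bits (w : word) : seq S := [seq inl b | b <- w].
Definition pairs (w : word) : word := flatten [seq [:: a; false] | a <- w].

Lemma inc_lead (c : bool) tp o o2 t t2 x x2 i fl :
  lead (2 * size x + 4) ((Inc c, mkstore tp o o2 t t2 (bits x) x2 i fl) : sstate prog * store prog)
    (let x' := if c then succ_word x else x in
     (Copy, mkstore tp o o2 (hole :: inl false :: bits (rev (pairs x')) ++ t) t2 [::]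
       (bits (rev x') ++ x2) i fl)).
Proof.
elim: x c t x2 => [|b x IH] c t x2.
  case: c => /=; last first.
    apply: (@lead_trans prog 1 1 _ _
      (IncE, mkstore tp o o2 (inl false :: t) t2 [::] x2 i fl)) => //; det.
  (* The carry has passed all digits. In bijective numeration the successor then has one more digit,
     [false]. *)
  apply: (@lead_trans prog 1 3 _ _
      (IncB false, mkstore tp o o2 (inl false :: t) t2 [::] (inl false :: x2) i fl)) => //.
    by det.
  apply: (@lead_trans prog 1 2 _ _
      (Inc false, mkstore tp o o2 [:: inl false, inl false & t] t2 [::] (inl false :: x2) i fl)) => //.
    by det.
  apply: (@lead_trans prog 1 1 _ _
      (IncE, mkstore tp o o2 [:: inl false, inl false, inl false & t] t2 [::] (inl false :: x2) i fl)) => //.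
    by det.
  by det.
apply: (@lead_trans prog 1 (2 * size x + 5) _ _
      (IncB (c && b), mkstore tp o o2 (inl (b (+) c) :: t) t2 (bits x) (inl (b (+) c) :: x2) i fl)).
- by det.
- apply: (@lead_trans prog 1 (2 * size x + 4) _ _
      (Inc (c && b), mkstore tp o o2 (inl false :: inl (b (+) c) :: t) t2 (bits x) (inl (b (+) c) :: x2) i fl)).
  + by det.
  + have -> : (if c then succ_word (b :: x) else b :: x) =
       (b (+) c) :: (if c && b then succ_word x else x) by case: (c); case: (b).
    set x' := if c && b then _ else _.
    rewrite /pairs /= -/(pairs x') !rev_cons -!cats1 -!catA /= /bits !map_cat -!catA /=.
    exact: IH.
  + by rewrite add1n -addnS.
- by rewrite /=; lia.
Qed.

Lemma push_input_write (t : V -> option S) (st : store prog) x b p :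
  t = tops st ->
  (forall k c, st (inl (k, c)) = [seq cell s | s <- if c then (input_tapes x k).2
                                   else (input_tapes x k).1]) ->
  act (push_input t b p) (st (inl p)) =
  [seq cell s | s <- if p.2 then (input_tapes (b :: x) p.1).2 else (input_tapes (b :: x) p.1).1].
Proof.
move=> ->; case: p => k c h; rewrite /push_input /tops h /=.
rewrite [_ == _]/= xpair_eqE /input_tapes /= !ffunE.
by case: eqP => _; case: c => //=; rewrite ?act_push ?act_keep.
Qed.

Lemma copy_lead o o2 t t2 x x2 y i fl :
  lead (size x2).+1 ((Copy, mkstore (input_tapes y) o o2 t t2 x (bits x2) i fl) : sstate prog * store prog)
    (Sim false (start N), mkstore (input_tapes (rev x2 ++ y)) o o2 t t2 (bits (rev x2) ++ x) [::] i fl).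
Proof.
elim: x2 x y => [|b x2 IH] x y; first by rewrite /=; det.
apply: (@lead_trans prog 1 (size x2).+1 _ _
   (Copy, mkstore (input_tapes (b :: y)) o o2 t t2 (inl b :: x) (bits x2) i fl)) => //.
  apply: lead_det; first by reflexivity.
  move=> [p|[]] /=; rewrite /keepR ?act_keep ?act_push //.
  by case: p => k c; exact: (push_input_write (x := y) b (k, c) erefl (fun _ _ => erefl)).
rewrite rev_cons -cats1 -catA /= /bits map_cat -catA /=; exact: IH.
Qed.

Lemma fin_lead o o2 t t2 x x2 y i fl :
  lead (size i).+1 ((Fin, mkstore (input_tapes y) o o2 t t2 x x2 (bits i) fl) : sstate prog * store prog)
    (Sim true (start N), mkstore (input_tapes (rev i ++ y)) o o2 t t2 x x2 [::] fl).
Proof.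
elim: i y => [|b i IH] y; first by rewrite /=; det.
apply: (@lead_trans prog 1 (size i).+1 _ _
   (Fin, mkstore (input_tapes (b :: y)) o o2 t t2 x x2 (bits i) fl)) => //.
  apply: lead_det; first by reflexivity.
  move=> [p|[]] /=; rewrite /keepR ?act_keep ?act_push //.
  by case: p => k c; exact: (push_input_write (x := y) b (k, c) erefl (fun _ _ => erefl)).
rewrite rev_cons -cats1 -catA; exact: IH.
Qed.

Definition consts_of (b : bool) (s : seq (bool * S)) : seq S :=
  [seq p.2 | p <- s & p.1 == b].

Lemma fill_lead m (j : 'I_(size consts).+1) tp o o2 t t2 x x2 i fl :
  size consts - j = m ->
  lead m.+1 ((Fill _ j, mkstore tp o o2 t t2 x x2 i fl) : sstate prog * store prog)
    (Loop, mkstore tp o o2 (rev (consts_of false (drop j consts)) ++ t) t2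
      (rev (consts_of true (drop j consts)) ++ x) x2 i fl).
Proof.
elim: m j t x => [|m IH] j t x hj.
  have le : size consts <= j by rewrite -subn_eq0 hj.
  rewrite drop_oversize //=; apply: lead_det; first by rewrite /det_delta onth_default.
  store_eq.
have lt : j < size consts by rewrite -subn_gt0 hj.
have [[b a] e] : exists p, onth consts j = Some p.
  by case E: (onth consts j) => [p|]; [exists p|move: E; rewrite -onthTE in lt; case: onth lt].
have ej : (inord j.+1 : 'I_(size consts).+1) = j.+1 :> nat by rewrite inordK.
have de : drop j consts = (b, a) :: drop j.+1 consts.
  by rewrite (drop_nth (b, a) lt); congr cons; apply: onth_nth.
apply: (@lead_trans prog 1 m.+1 _ _
  (Fill _ (inord j.+1), mkstore tp o o2 (if b then t else a :: t) t2
     (if b then a :: x else x) x2 i fl)) => //.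
  apply: lead_det; first by rewrite /det_delta e.
  by case: (b); store_eq.
have := IH (inord j.+1) (if b then t else a :: t) (if b then a :: x else x).
rewrite ej de /consts_of /= subnS hj => /(_ erefl).
by case: (b) => /=; rewrite rev_cons cat_rcons.
Qed.

Lemma sinit_prog x :
  sinit prog x = (Fill _ ord0, mkstore (input_tapes [::]) [::] [::] [::] [::] [::] [::] (bits (rev x)) [::]).
Proof.
rewrite /sinit /=; congr pair.
suff h y : foldl (fun st b => load (Some b) st) (mkstore (input_tapes [::]) [::] [::] [::] [::] [::] [::] y [::]) x =
  mkstore (input_tapes [::]) [::] [::] [::] [::] [::] [::] (bits (rev x) ++ y) [::].
  have -> : (fun=> [::]) = mkstore (input_tapes [::]) [::] [::] [::] [::] [::] [::] [::] [::].
    apply/funext => -[[k b]|[]] //=; rewrite /input_tapes /= ffunE.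
    by case: (k == ord0); case: b.
  by rewrite h cats0; apply/funext => -[[k b]|[]].
elim: x y => [|b x IH] y //=.
have -> : load (Some b) (mkstore (input_tapes [::]) [::] [::] [::] [::] [::] [::] y [::]) =
  mkstore (input_tapes [::]) [::] [::] [::] [::] [::] [::] (inl b :: y) [::].
  by apply/funext => -[[k c]|[]].
by rewrite IH rev_cons -cats1 /bits map_cat -catA.
Qed.
End Program.

(** * Correctness and running time of the program *)

(* Bijective base-two numeration: [succ_word] is the successor function. *)
Fixpoint val_word (x : word) : nat :=
  if x is b :: x then b.+1 + (val_word x).*2 else 0.

Definition word_of (i : nat) : word := iter i succ_word [::].

Lemma val_succ x : val_word (succ_word x) = (val_word x).+1.
Proof. by elim: x => [|[] x IH] //=; rewrite IH; lia. Qed.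

Lemma word_ofK i : val_word (word_of i) = i.
Proof. by elim: i => //= i IH; rewrite val_succ IH. Qed.

Lemma val_word_inj : injective val_word.
Proof.
elim=> [|a x IH] [|b y] //=; try by case: a || case: b; lia.
move=> h; have ab : a = b by move: h; case: a; case: b => //=; lia.
by rewrite ab; congr cons; apply: IH; move: h; rewrite ab; lia.
Qed.

Lemma val_wordK x : word_of (val_word x) = x.
Proof. by apply: val_word_inj; rewrite word_ofK. Qed.

Lemma val_word_lt x : (val_word x).+1 < 2 ^ (size x).+1.
Proof. by elim: x => [|[] x IH] //=; rewrite expnS; lia. Qed.

Lemma val_word_ge x : 2 ^ size x <= (val_word x).+1.
Proof. by elim: x => [|[] x IH] //=; rewrite expnS; lia. Qed.

Lemma size_val x : size x <= val_word x.
Proof. by elim: x => [|[] x IH] //=; lia. Qed.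

Lemma val_word_mono x y : val_word x <= val_word y -> size x <= size y.
Proof.
move=> le; rewrite -ltnS -(ltn_exp2l (m := 2)) //.
by apply: leq_ltn_trans (val_word_ge x) _; apply: leq_ltn_trans _ (val_word_lt y).
Qed.

(** As the base is at least two, the exponent absorbs constant factors and summands, and one number
    [k] describes the bound. *)
Definition poly_bounded (f : nat -> nat) : Prop := exists k, forall n, f n <= (n + 2) ^ k.

Lemma poly_bounded_const c : poly_bounded (fun=> c).
Proof.
exists c => n; apply: (@leq_trans (2 ^ c)); first exact: ltnW (ltn_expl _ _).
by case: c => // c; rewrite leq_exp2r // leq_addl.
Qed.

Lemma poly_bounded_id : poly_bounded id.
Proof. by exists 1 => n; rewrite expn1 leq_addr. Qed.

Lemma poly_boundedM f g : poly_bounded f -> poly_bounded g -> poly_bounded (fun n => f n * g n).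
Proof.
by move=> [k hk] [l hl]; exists (k + l) => n; rewrite expnD leq_mul.
Qed.

Lemma poly_boundedD f g : poly_bounded f -> poly_bounded g -> poly_bounded (fun n => f n + g n).
Proof.
move=> [k hk] [l hl]; exists (k + l).+1 => n.
rewrite expnS expnD mulnDl.
have h1 : 0 < (n + 2) ^ k by rewrite expn_gt0 addn2.
have h2 : 0 < (n + 2) ^ l by rewrite expn_gt0 addn2.
have := hk n; have := hl n; move: ((n + 2) ^ k) ((n + 2) ^ l) h1 h2 => a b; nia.
Qed.

Lemma poly_boundedX f k : poly_bounded f -> poly_bounded (fun n => f n ^ k).
Proof.
elim: k => [|k IH] h; first exact: poly_bounded_const.
have [l hl] := poly_boundedM h (IH h).
by exists l => n; rewrite expnS.
Qed.

(** The code of [x] whose witness bits are all [false]; see [code_zeros]. *)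
Definition zero_code (x : word) (b : bool) : word := pairs x ++ [:: false; b].

Lemma size_pairs x : size (pairs x) = (size x).*2.
Proof. by elim: x => //= a x ->. Qed.

Section Simulation.
Variables (N : machine) (target : outcome).
Notation S := (bool + option (symbol (aux N)))%type.
Variables (es0 : seq (seq S)) (x_first : word).

Definition consts0 : seq (bool * S) :=
  [seq (true, a) | a <- rev (bits N x_first)] ++ [seq (false, a) | a <- rev (table es0)].

Notation M := (prog target consts0).

Definition loop_config es x i fl : sstate M * store M :=
  (Loop, mkstore (consts := consts0) (input_tapes N [::]) [::] [::] (table es) [::] (bits N x) [::] (bits N i) fl).

Lemma loop_sacc k es x i fl : sacc k (loop_config es x i fl) ->
  exists k' c', [/\ k = k'.+1, sstep (loop_config es x i fl) c' & sacc k' c'].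
Proof. exact: sacc_step. Qed.

Definition open_entry (x : word) : seq S := hole N :: inl false :: bits N (rev (pairs x)).

Definition entry (x : word) (b : bool) : seq S := bits N (rev (zero_code x b)).

Lemma start_lead x :
  lead (size consts0).+1 (sinit M x) (loop_config es0 x_first (rev x) [::]).
Proof.
rewrite sinit_prog.
have := @fill_lead N target consts0 _ ord0 (input_tapes N [::]) [::] [::] [::] [::] [::] [::]
  (bits N (rev x)) [::] (subn0 _).
rewrite drop0 /consts_of /consts0 !filter_cat !filter_map.
have -> : filter (preim (pair true) (fun p => p.1 == false)) (rev (bits N x_first)) = [::].
  by rewrite (eq_filter (a2 := pred0)) ?filter_pred0.
have -> : filter (preim (pair false) (fun p => p.1 == true)) (rev (table es0)) = [::].
  by rewrite (eq_filter (a2 := pred0)) ?filter_pred0.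
rewrite !(eq_filter (a2 := predT)) // !filter_predT !cats0 /= -!map_comp !map_id_in // !revK.
exact.
Qed.

Lemma inc_copy_lead es x i fl :
  lead (2 * size x + size (succ_word x) + 6)
    ((Inc true, mkstore (consts := consts0) (input_tapes N [::]) [::] [::] (hash N :: table es) [::] (bits N x) [::]
      (bits N i) fl) : sstate M * store M)
    (sim_config target consts0 false (init N (succ_word x))
      (open_entry (succ_word x) :: es) (bits N (succ_word x)) (bits N i) fl).
Proof.
have h1 := inc_lead target consts0 true (input_tapes N [::]) [::] [::] (hash N :: table es) [::] x [::]
  (bits N i) fl.
have h2 := copy_lead target consts0 [::] [::] (table (open_entry (succ_word x) :: es)) [::] [::]
  (rev (succ_word x)) [::] (bits N i) fl.
rewrite !cats0 revK in h2; move: h1; rewrite /= cats0 => h1.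
have e : table (open_entry (succ_word x) :: es) =
  hole N :: inl false :: bits N (rev (pairs (succ_word x))) ++ hash N :: table es.
  by rewrite /table /= cat_rcons.
rewrite e in h2; rewrite /sim_config e.
apply: lead_trans h1 h2 _; rewrite size_rev; lia.
Qed.

Lemma entryE x b es : inl b :: behead (table (open_entry x :: es)) = table (entry x b :: es).
Proof.
by rewrite /table /= /entry /zero_code rev_cat.
Qed.

Lemma wf_open x es : wf_entries es -> wf_entries (open_entry x :: es).
Proof.
move=> h; rewrite /= h andbT /open_entry !inE /=.
by apply/mapP => -[].
Qed.

Lemma wf_entry x b es : wf_entries es -> wf_entries (entry x b :: es).
Proof. by move=> h; rewrite /= h andbT; apply/mapP => -[]. Qed.

Lemma table_lang_open x es : table_lang (open_entry x :: es) = table_lang es.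
Proof.
apply/seteqP; split=> w; rewrite /table_lang /= inE; last by move=> ->; rewrite orbT.
by case: (rev w).
Qed.

Lemma bits_inj : injective (bits N).
Proof. by apply: inj_map => a b []. Qed.

Lemma table_lang_entry x b es w : table_lang (entry x b :: es) w <-> w = zero_code x b \/ table_lang es w.
Proof.
rewrite /table_lang /= inE; split.
  by case/orP=> [/eqP /bits_inj /(can_inj revK) ->|]; [left|right].
by case=> [->|->]; rewrite ?eqxx ?orbT.
Qed.

Lemma write_move_size (tp : tape (aux N)) a :
  size (write_move tp a).1 <= (size tp.1).+2 /\ size (write_move tp a).2 <= (size tp.2).+2.
Proof.
by case: tp a => l r [s []] /=; rewrite ?size_behead; split; lia.
Qed.

Lemma step_tapes D (c c' : config N) k : step D c c' ->
  size (ctapes c' k).1 <= (size (ctapes c k).1).+2 /\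
  size (ctapes c' k).2 <= (size (ctapes c k).2).+2.
Proof.
rewrite /step; case: kind => [|y n|//].
  by case=> a _ -> /=; rewrite ffunE; apply: write_move_size.
by case=> -[_ ->] /=; split; lia.
Qed.

Lemma steps_tapes D n (c c' : config N) k : steps D n c c' ->
  size (ctapes c' k).1 <= size (ctapes c k).1 + 2 * n /\
  size (ctapes c' k).2 <= size (ctapes c k).2 + 2 * n.
Proof.
elim: n c => [|n IH] c /=; first by move=> ->; rewrite !addn0.
have e s : s + 2 * n.+1 = s.+2 + 2 * n by lia.
case=> d /(@step_tapes _ _ _ k) [h1 h2] /IH [h3 h4]; rewrite !e.
by split; [apply: leq_trans h3 _|apply: leq_trans h4 _]; rewrite leq_add2r.
Qed.

Lemma steps_coracle D n (c c' : config N) : steps D n c c' ->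
  size (coracle c') <= size (coracle c) + n.
Proof.
elim: n c => [|n IH] c /=; first by move=> ->; rewrite addn0.
by case=> d /step_coracle h1 /IH h2; lia.
Qed.

Lemma steps_init_size D n x (c : config N) : steps D n (init N x) c ->
  (forall k, size (ctapes c k).1 <= size x + 2 * n /\ size (ctapes c k).2 <= size x + 2 * n) /\
  size (coracle c) <= size x + 2 * n.
Proof.
move=> h; split=> [k|]; last by have := steps_coracle h; rewrite /=; lia.
have := steps_tapes k h; rewrite /= ffunE.
by case: ifP => _ /=; rewrite ?size_map; lia.
Qed.

Variables (A : language) (D : nat -> language) (i0 : nat) (p : nat).
Notation P n := ((n + 2) ^ p).

Definition claims (o : outcome) (x : word) : Prop :=
  match o with Acc => A x | Rej => ~ A x | Unk => True end.

Hypothesis target_decides : target <> Unk.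
Hypothesis stage0 : table_lang es0 = D i0.
Hypothesis wf0 : wf_entries es0.
Hypothesis X0E : (val_word x_first).+1 = i0.
Hypothesis stageS : forall i w, i0 <= i ->
  D i.+1 w <-> w = zero_code (word_of i) `[< A (word_of i) >] \/ D i w.
Hypothesis time_bound : forall E x n c, steps E n (init N x) c -> n <= P (size x).
Hypothesis decides : forall E x, exists n c b,
  steps E n (init N x) c /\ kind (cstate c) = Halt (outcome_of b).
Hypothesis i0_large : forall z, i0 <= val_word z -> P (size z) < 2 ^ (size z).+1.
Hypothesis correct : forall i x n c o, i0 <= i -> steps (D i) n (init N x) c ->
  kind (cstate c) = Halt o -> (forall z, i <= val_word z -> n < 2 ^ (size z).+1) ->
  claims o x.

Lemma succ_word_of X i : (val_word X).+1 = i -> succ_word X = word_of i.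
Proof. by move=> e; apply: val_word_inj; rewrite val_succ word_ofK. Qed.

Lemma stage_correct i n c b : i0 <= i -> steps (D i) n (init N (word_of i)) c ->
  kind (cstate c) = Halt (outcome_of b) -> b = `[< A (word_of i) >].
Proof.
move=> le st kc.
(* The run is on [word_of i], which is no longer than any [z] of index at least [i]; so its time
   bound is below the number of witnesses of [z]. *)
have small z : i <= val_word z -> n < 2 ^ (size z).+1.
  move=> iz; apply: leq_ltn_trans (time_bound st) _.
  apply: leq_trans (i0_large _) _; first by rewrite word_ofK.
  by rewrite leq_exp2l // ltnS; apply: val_word_mono; rewrite word_ofK.
have := correct le st kc small; case: (b) => /=; first by move=> h; apply/esym/asboolP.
by move=> h; apply/esym/asboolPn.
Qed.

Lemma stage_next es i : i0 <= i -> table_lang es = D i ->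
  table_lang (entry (word_of i) `[< A (word_of i) >] :: es) = D i.+1.
Proof.
move=> le h; apply/seteqP; split=> w; rewrite table_lang_entry stageS // h; tauto.
Qed.

Lemma loop_sound k es i X x fl : i0 <= i -> table_lang es = D i -> wf_entries es ->
  (val_word X).+1 = i -> size fl = i - i0 ->
  sacc k (loop_config es X (rev x) fl) -> claims target x.
Proof.
elim/ltn_ind: k es i X fl => k IH es i X fl le lE wf Xi flE.
move=> /loop_sacc [k1 [d [kE /loop_step [] -> h1]]]; last first.
  have [h2 _] := fin_lead target consts0 [::] [::] (table es) [::] (bits N X) [::] [::] (rev x) fl.
  have [k2 _ h3] := h2 _ h1; rewrite cats0 revK in h3.
  have [n [c [o [k3 [st kc nle _ h4]]]]] :=
    @sim_sound N target consts0 k2 true (init N x) es (bits N X) [::] fl wf h3.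
  have oE := sim_halt_final kc h4; rewrite -oE.
  (* The fuel gives [n <= i - i0], and a word of index at least [i] has more than [i] witnesses. *)
  rewrite lE in st; apply: (correct le st kc) => z iz.
  have := nle isT; have := val_word_lt z; lia.
have [h2 _] := inc_copy_lead es X (rev x) (hash N :: fl).
have [k2 k2le h3] := h2 _ h1; rewrite (succ_word_of Xi) in h3.
have [n [c [o [k3 [st kc _ k3le h4]]]]] := sim_sound (wf_open _ wf) h3.
rewrite table_lang_open lE in st.
have [k4 [d' [k4E /(sim_halt _ _ _ _ _ kc) [b ob ->] h5]]] := sim_sacc h4.
rewrite ob in kc; have bE := stage_correct le st kc.
have [tpB oB] := steps_init_size st.
have [h6 _] := clear_lead target consts0 [::] (inl b :: behead (table (open_entry (word_of i) :: es)))
   [::] (bits N (word_of i)) [::] (bits N (rev x)) (spend false n (hash N :: fl)) tpB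
   (o := bits N (rev (coracle c))) (eq_ind_r (fun s => s <= _) oB (etrans (size_map _ _) (size_rev _))).
have [k5 k5le h7] := h6 _ h5; rewrite entryE bE in h7.
apply: (IH k5 _ _ i.+1 (word_of i) _ _ _ _ _ _ h7).
- by rewrite kE (leq_ltn_trans k5le) // ltnS (leq_trans _ k2le) // (leq_trans _ k3le) // k4E.
- by rewrite ltnW.
- exact: stage_next.
- exact: wf_entry.
- by rewrite word_ofK.
- by rewrite /= flE subSn.
Qed.

Lemma size_table_entry x b es :
  size (table (entry x b :: es)) = 2 * size x + 3 + size (table es).
Proof.
rewrite /table /= size_cat size_rcons /entry /bits size_map size_rev /zero_code size_cat.
by rewrite size_pairs /= -mul2n; congr addn; rewrite addn2 addn3.
Qed.

Lemma size_table_open x b es : size (table (open_entry x :: es)) = size (table (entry x b :: es)).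
Proof. by rewrite -entryE /= . Qed.

Lemma leq_P m n : m <= n -> P m <= P n.
Proof. by move=> le; case: (p) => // q; rewrite leq_exp2r // leq_add2r. Qed.

Definition run_cost (T L : nat) : nat := L * (T * (3 * L + 4) + L + 4).

Lemma sim_cost (es : seq (seq S)) T n L : size (table es) <= T -> n <= L ->
  n * (query_cost es L).+1 <= run_cost T L.
Proof.
move=> hT hn; rewrite /query_cost /run_cost; apply: leq_mul => //.
by rewrite -addnS leq_add // leq_add2r leq_mul2r hT orbT.
Qed.

(** The entry of a word of length [n] occupies [2 * n + 3] symbols with its [hash], and [word_of i]
    has length at most [i]. *)
Definition table_bound (j : nat) : nat := size (table es0) + j.+1 * (2 * j + 3).

Definition iter_cost (j : nat) : nat :=
  4 * j + 2 * P j + run_cost (table_bound j) (P j) + 20.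

Definition final_cost (j n : nat) : nat := n + 3 + run_cost (table_bound j) (P n).

(** [d] counts the answers still to be computed. The path stops filling the table at index
    [i0 + P (size x)], when the fuel equals the time bound of [N] on [x]. *)
Lemma loop_complete x d es i X fl : claims target x -> i0 <= i ->
  i + d = i0 + P (size x) -> table_lang es = D i -> wf_entries es ->
  size (table es) <= size (table es0) + i * (2 * (i0 + P (size x)) + 3) ->
  (val_word X).+1 = i -> size fl = i - i0 ->
  exists2 k, k <= d * iter_cost (i0 + P (size x)) + final_cost (i0 + P (size x)) (size x) &
    sacc k (loop_config es X (rev x) fl).
Proof.
set J := i0 + P (size x); move=> hx.
elim: d es i X fl => [|d IH] es i X fl le id lE wf tE Xi flE.
  have [n [c [b [st kc]]]] := decides (D i) x.
  have nP := time_bound st.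
  rewrite addn0 in id.
  have nfl : n <= size fl by rewrite flE id /J addKn.
  (* The verdict of this path is right, and [claims target x] excludes the opposite one. *)
  have oc : outcome_of b = target.
    have nz z : i <= val_word z -> n < 2 ^ (size z).+1.
      by move=> iz; have := val_word_lt z; lia.
    move: (correct le st kc nz) hx target_decides.
    by case: (b); case: target => //=; tauto.
  rewrite oc in kc; rewrite -lE in st.
  have h1 := sim_halt_target consts0 es (bits N X) [::] (spend true n fl) kc.
  have [|k kle h2] := sim_complete wf st (L := P (size x)) (fun _ => nfl) _ h1; first by [].
  have [_ h3] := fin_lead target consts0 [::] [::] (table es) [::] (bits N X) [::] [::] (rev x) fl.
  rewrite cats0 revK in h3; have [k' k'le [c' h4 h5]] := h3 _ h2.
  exists k'.+1.
    rewrite mul0n add0n /final_cost.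
    have := @sim_cost es (table_bound J) n (P (size x)).
    have -> : size (table es) <= table_bound J.
      by rewrite (leq_trans tE) // leq_add2l leq_mul // id.
    move=> /(_ isT nP); move: k'le kle; rewrite size_rev; lia.
  by exists c' => //; eexists; last exact: h4; apply/loop_step; right.
have iJ : i < J by rewrite -id; lia.
have [n [c [b [st kc]]]] := decides (D i) (word_of i).
have nP := time_bound st.
have bE := stage_correct le st kc.
have zi : size (word_of i) <= i by rewrite -{2}(word_ofK i) size_val.
have nPJ : n <= P J by rewrite (leq_trans nP) // leq_P // (leq_trans zi) // ltnW.
have tE' : size (table (entry (word_of i) `[< A (word_of i) >] :: es)) <=
    size (table es0) + i.+1 * (2 * J + 3).
  by rewrite size_table_entry mulSn; lia.
have [|||||||k kle h1] := IH (entry (word_of i) `[< A (word_of i) >] :: es) i.+1 (word_of i)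
   (hash N :: fl).
- by rewrite ltnW.
- by rewrite -id addSnnS.
- exact: stage_next.
- exact: wf_entry.
- exact: tE'.
- by rewrite word_ofK.
- by rewrite /= flE subSn.
have [tpB oB] := steps_init_size st.
have [_ h2] := clear_lead target consts0 [::] (inl b :: behead (table (open_entry (word_of i) :: es)))
   [::] (bits N (word_of i)) [::] (bits N (rev x)) (hash N :: fl) tpB
   (o := bits N (rev (coracle c))) (eq_ind_r (fun s => s <= _) oB (etrans (size_map _ _) (size_rev _))).
rewrite entryE bE in h2; have [k1 k1le h3] := h2 _ h1.
have h4 : sacc k1.+1 (sim_config target consts0 false c (open_entry (word_of i) :: es)
     (bits N (word_of i)) (bits N (rev x)) (spend false n (hash N :: fl))).
  case: h3 => c' h31 h32; exists c' => //; eexists; last exact: h31.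
  by apply/(sim_halt _ _ _ _ _ kc); exists b => //; rewrite entryE bE.
rewrite -lE -(table_lang_open (word_of i)) in st.
have [||k2 k2le h5] := sim_complete (wf_open _ wf) st (L := P J) _ _ h4; [by []|by []|].
have [_ h6] := inc_copy_lead es X (rev x) (hash N :: fl).
rewrite (succ_word_of Xi) in h6; have [k3 k3le [c' h7 h8]] := h6 _ h5.
exists k3.+1; last first.
  by exists c' => //; eexists; last exact: h7; apply/loop_step; left.
have := @sim_cost (open_entry (word_of i) :: es) (table_bound J) n (P J).
have -> : size (table (open_entry (word_of i) :: es)) <= table_bound J.
  rewrite (size_table_open _ `[< A (word_of i) >]) (leq_trans tE') // leq_add2l leq_mul //.
  by rewrite ltnW.
have X_le : size X <= i by rewrite (leq_trans (size_val _)) // -Xi.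
move=> /(_ isT nPJ); move: k3le k2le k1le kle; rewrite mulSn /iter_cost; lia.
Qed.

Lemma cost_poly_bounded : poly_bounded (fun n => (size consts0).+1 +
  (P n * iter_cost (i0 + P n) + final_cost (i0 + P n) n)).
Proof.
have bP : poly_bounded (fun n => P n).
  by apply/poly_boundedX/poly_boundedD; [exact: poly_bounded_id|exact: poly_bounded_const].
have bJ : poly_bounded (fun n => i0 + P n) by apply: poly_boundedD => //; exact: poly_bounded_const.
have bPJ : poly_bounded (fun n => P (i0 + P n)).
  by apply/poly_boundedX/poly_boundedD => //; exact: poly_bounded_const.
have bT : poly_bounded (fun n => table_bound (i0 + P n)).
  apply: poly_boundedD; first exact: poly_bounded_const.
  apply: poly_boundedM; last first.
    apply: poly_boundedD; last exact: poly_bounded_const.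
    by apply: poly_boundedM => //; exact: poly_bounded_const.
  have [k hk] := poly_boundedD (poly_bounded_const 1) bJ; exists k => n; exact: hk.
have bR L : poly_bounded L -> poly_bounded (fun n => run_cost (table_bound (i0 + P n)) (L n)).
  move=> bL; apply: poly_boundedM => //; apply: poly_boundedD; last exact: poly_bounded_const.
  apply: poly_boundedD => //; apply: poly_boundedM => //; apply: poly_boundedD; last exact: poly_bounded_const.
  by apply: poly_boundedM => //; exact: poly_bounded_const.
apply: poly_boundedD; first exact: poly_bounded_const.
apply: poly_boundedD; last first.
  apply: poly_boundedD; last exact: bR.
  by apply: poly_boundedD; [exact: poly_bounded_id|exact: poly_bounded_const].
apply: poly_boundedM => //; apply: poly_boundedD; last exact: poly_bounded_const.
apply: poly_boundedD; last exact: bR.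
by apply: poly_boundedD; apply: poly_boundedM => //; exact: poly_bounded_const.
Qed.

Lemma claims_NP : NP (claims target).
Proof.
have [k hk] := cost_poly_bounded.
apply: (@NP_stack _ M k) => [x hx|x n h].
  have [|||||n nle h] := @loop_complete x (P (size x)) es0 i0 x_first [::] hx (leqnn _) erefl => //.
  - by rewrite leq_addr.
  - by rewrite subnn.
  have [_ h1] := start_lead x; have [n' n'le h2] := h1 _ h.
  exists n' => //; apply: leq_trans (hk _); apply: leq_trans n'le _.
  by rewrite leq_add2l.
have [h1 _] := start_lead x; have [n' _ h2] := h1 _ h.
by apply: loop_sound (leqnn _) stage0 wf0 X0E _ h2; rewrite subnn.
Qed.

End Simulation.

(** * Codes and the reduction *)

(* [x] and the witness [y] are interleaved so that the reduction can write
   [code x y b] while it scans [x]. *)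
Fixpoint code (x y : word) (b : bool) : word :=
  if x is a :: x then [:: a, head false y & code x (behead y) b]
  else [:: head false y; b].

Definition correct_codes (A B : language) : Prop :=
  (forall x y b, size y = (size x).+1 -> B (code x y b) -> (b <-> A x)) /\
  (forall x, exists2 y, size y = (size x).+1 & exists b, B (code x y b)).

Lemma size_code x y b : size (code x y b) = (size x).+1.*2.
Proof. by elim: x y => [|a x IH] y //=; rewrite IH. Qed.

Lemma code_inj x y b x' y' b' : size y = (size x).+1 -> size y' = (size x').+1 ->
  code x y b = code x' y' b' -> [/\ x = x', y = y' & b = b'].
Proof.
elim: x x' y y' => [|a x IH] [|a' x'] [|c y] [|c' y'] //= hy hy' e.
- by case: y y' hy hy' e => [|? ?] [|? ?] //= _ _ [-> ->].
- by have := congr1 size e; rewrite /= size_code.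
- by have := congr1 size e; rewrite /= size_code.
- case: hy => hy; case: hy' => hy'.
  by case: e => <- <- /(IH _ _ _ hy hy') [<- <- <-].
Qed.

Lemma code_zeros x b : code x (nseq (size x).+1 false) b = zero_code x b.
Proof.
suff h y : (forall n, nth false y n = false) -> code x y b = zero_code x b.
  by apply: h => n; rewrite nth_nseq if_same.
elim: x y => [|a x IH] y h; first by rewrite /= -nth0 h.
rewrite /= -nth0 h /zero_code /= IH // => n.
by rewrite nth_behead h.
Qed.

(** Pigeonhole: distinct witnesses give distinct codes, and there are more witnesses than words in
    [qs]. *)
Lemma code_avoid (qs : seq word) x b : size qs < 2 ^ (size x).+1 ->
  exists2 y, size y = (size x).+1 & code x y b \notin qs.
Proof.
move=> lt; apply: contrapT => h.
have sub (t : (size x).+1.-tuple bool) : code x t b \in qs.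
  apply: contrapT => /negP nin; apply: h; exists t => //; exact: size_tuple.
have inj : injective (fun t : (size x).+1.-tuple bool => code x t b).
  by move=> t t' /code_inj; rewrite !size_tuple => /(_ erefl erefl) [_ /val_inj ->].
have := @uniq_leq_size _ [seq code x (val t) b | t <- enum {: (size x).+1.-tuple bool}] qs.
rewrite map_inj_uniq ?enum_uniq // size_map -cardE card_tuple card_bool leqNgt lt.
by move=> h'; apply: (negP (h' isT _)) => // w /mapP [t _ ->]; exact: sub.
Qed.

Lemma steps_use N D n (c c' : config N) : steps D n c c' ->
  exists2 qs : seq word, size qs <= n &
    forall E, (forall w, w \in qs -> D w <-> E w) -> steps E n c c'.
Proof.
elim: n c => [|n IH] c /=; first by move=> ->; exists [::].
case=> d cd /IH [qs le h].
(* The oracle tape is recorded at every step, queried or not; one word per step is all that the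
   bound allows and needs. *)
exists (coracle c :: qs) => // E hE; exists d; last first.
  by apply: h => w hw; apply: hE; rewrite inE hw orbT.
move: cd; rewrite /step; case: kind => // y z.
by rewrite (propext (hE (coracle c) (mem_head _ _))).
Qed.

(* [inl None]: copy an input bit; [inl (Some false)]: guess a bit of the
   witness; [inl (Some true)]: guess the answer; [inr (inl b)]: query with the
   guessed answer [b]; [inr (inr o)]: halt. *)
Definition guess_state : finType := (option bool + (bool + option bool))%type.

Definition guess_kind (q : guess_state) : state_kind guess_state :=
  match q with
  | inl _ => Compute
  | inr (inl b) => Ask (inr (inr (Some b))) (inr (inr None))
  | inr (inr (Some b)) => Halt (outcome_of b)
  | inr (inr None) => Halt Unk
  end.

Definition guess_trans (q : guess_state) (r : {ffun 'I_1 -> symbol void}) :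
    {set guess_state * {ffun 'I_1 -> symbol void * move} * option bool} :=
  let go m := [ffun i => (r i, m)] in
  match q with
  | inl None =>
      if r ord0 is Some (inl a) then [set (inl (Some false), go MoveRight, Some a)]%SET
      else [set (inl (Some true), go Stay, Some b) | b : bool]%SET
  | inl (Some false) => [set (inl None, go Stay, Some b) | b : bool]%SET
  | inl (Some true) => [set (inr (inl b), go Stay, Some b) | b : bool]%SET
  | inr _ => finset.set0
  end.

Definition guesser : machine := @Machine guess_state void 0 (inl None) guess_kind guess_trans.

Definition guess_move (tp : {ffun 'I_1 -> tape void}) (m : move) : {ffun 'I_1 -> tape void} :=
  [ffun i => write_move (tp i) (read (tp i), m)].

Definition guess_config (q : guess_state) (tp : {ffun 'I_1 -> tape void}) (w : word) :
  config guesser := @Config guesser q tp w.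

Lemma guess_moveE (tp : {ffun 'I_1 -> tape void}) m :
  [ffun i => write_move (tp i) ([ffun i => ([ffun i => read (tp i)] i, m)] i)] = guess_move tp m.
Proof. by apply/ffunP => i; rewrite !ffunE. Qed.

Lemma step_guess D (s : bool) tp w c : step D (guess_config (inl (Some s)) tp w) c <->
  exists b, c = guess_config (if s then inr (inl b) else inl None) (guess_move tp Stay) (rcons w b).
Proof.
rewrite /step; case: s => /=; split.
- by case=> a /imsetP [b _ ->] ->; exists b; rewrite /= guess_moveE.
- by case=> b ->; eexists; [apply/imsetP; exists b|rewrite -guess_moveE].
- by case=> a /imsetP [b _ ->] ->; exists b; rewrite /= guess_moveE.
- by case=> b ->; eexists; [apply/imsetP; exists b|rewrite -guess_moveE].
Qed.

Lemma step_scan D tp w c : step D (guess_config (inl None) tp w) c <->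
  if read (tp ord0) is Some (inl a)
  then c = guess_config (inl (Some false)) (guess_move tp MoveRight) (rcons w a)
  else exists b, c = guess_config (inl (Some true)) (guess_move tp Stay) (rcons w b).
Proof.
rewrite /step /= ffunE; case: (read _) => [[a|[]]|]; split.
- by case=> d /set1P -> ->; rewrite /= guess_moveE.
- by move=> ->; eexists; [apply/set1P|rewrite -guess_moveE].
- by case=> a /imsetP [b _ ->] ->; exists b; rewrite /= guess_moveE.
- by case=> b ->; eexists; [apply/imsetP; exists b|rewrite -guess_moveE].
Qed.

(** A measure that every step decreases: an input letter counts twice, for the step that copies it
    and the step that guesses a witness bit. *)
Definition guess_rank (c : config guesser) : nat :=
  let letters := count (fun a => a != None) (ctapes c ord0).2 in
  match (cstate c : guess_state) with
  | inl None => 2 * letters + 4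
  | inl (Some false) => 2 * letters + 5
  | inl (Some true) => 3
  | inr (inl _) => 1
  | inr (inr _) => 0
  end.

Lemma grank_step D c c' : step D c c' -> guess_rank c' < guess_rank c.
Proof.
case: c => -[[s|]|[b|o]] tp w.
- move/step_guess => [b ->]; case: s => //; rewrite /guess_rank /= ffunE /read.
  by case: (tp ord0) => l [|? r] /=; lia.
- move/step_scan; case E: (tp ord0) => [l r].
  case: r E => [|[[a|[]]|] r] E /=.
  + by case=> b ->; rewrite /guess_rank /=; lia.
  + by move=> ->; rewrite /guess_rank /= ffunE E /=; lia.
  + by case=> b ->; rewrite /guess_rank /=; lia.
- by case=> -[_ ->].
- by case: o.
Qed.

Lemma guesser_live D c :
  (exists o, kind (cstate c) = Halt o) \/ exists c' : config guesser, step D c c'.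
Proof.
case: c => -[[s|]|[b|o]] tp w.
- by right; eexists; apply/step_guess; exists true.
- right; case E: (read (tp ord0)) => [[a|[]]|].
    by eexists; apply/step_scan; rewrite E.
  by eexists; apply/step_scan; rewrite E; exists true.
- have [h|h] := pselect (D w); right; eexists; first by left.
  by right.
- by left; case: o => [b|]; eexists.
Qed.

Lemma guesser_nptm : nptm guesser.
Proof.
split=> [D x n c _|]; first exact: guesser_live.
exists ('X + 'X + 4%:P)%R => D x n c h.
suff : n + guess_rank c <= (size x).*2 + 4.
  rewrite !hornerD hornerX hornerC -addnn => le; exact: leq_trans (leq_addr _ _) le.
have -> : (size x).*2 + 4 = guess_rank (init guesser x).
  by rewrite /guess_rank /= ffunE /= count_map (eq_count (a2 := predT)) // count_predT mul2n.
elim: n (init _ _) h => [|n IH] d /=; first by move=> ->.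
by case=> e /grank_step lt /IH le; rewrite addSn (leq_ltn_trans le).
Qed.

Definition halts (N : machine) (D : language) (c : config N) (o : outcome) : Prop :=
  exists n c', steps D n c c' /\ kind (cstate c') = Halt o.

Lemma halts_step N D (c : config N) o : (forall o', kind (cstate c) <> Halt o') ->
  halts D c o <-> exists2 c', step D c c' & halts D c' o.
Proof.
move=> nh; split; last first.
  by case=> d cd [n [c' [st kc]]]; exists n.+1, c'; split=> //; exists d.
case=> -[|n] [c' [/= st kc]]; first by case: (nh o); rewrite st.
by case: st => d cd dc'; exists d => //; exists n, c'.
Qed.

Lemma halts_halt N D (c : config N) o o' : kind (cstate c) = Halt o' ->
  halts D c o <-> o = o'.
Proof.
move=> kc; split; last by move=> ->; exists 0, c.
case=> -[|n] [c' [/= st k']]; first by move: k'; rewrite -st kc => -[].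
by case: st => d; rewrite /step kc.
Qed.

Definition verdict (D : language) (w : word) (b : bool) (o : outcome) : Prop :=
  (D w /\ o = outcome_of b) \/ (~ D w /\ o = Unk).

Lemma guesser_ask D tp w b o :
  halts D (guess_config (inr (inl b)) tp w) o <-> verdict D w b o.
Proof.
rewrite halts_step //; split.
  case=> c; rewrite /step /= => -[[h ->]|[h ->]].
    by rewrite (@halts_halt _ _ _ _ (outcome_of b)) // => ->; left.
  by rewrite (@halts_halt _ _ _ _ Unk) // => ->; right.
case=> -[h ->].
  exists (guess_config (inr (inr (Some b))) tp [::]); first by left.
  by apply/(@halts_halt _ _ _ _ (outcome_of b)).
exists (guess_config (inr (inr None)) tp [::]); first by right.
by apply/(@halts_halt _ _ _ _ Unk).
Qed.

Lemma guesser_answer D tp w o :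
  halts D (guess_config (inl (Some true)) tp w) o <-> exists b, verdict D (rcons w b) b o.
Proof.
rewrite halts_step //; split.
  by case=> c /step_guess [b ->] /guesser_ask h; exists b.
case=> b h; exists (guess_config (inr (inl b)) (guess_move tp Stay) (rcons w b)).
  by apply/step_guess; exists b.
exact/guesser_ask.
Qed.

Lemma guesser_halts D x (tp : {ffun 'I_1 -> tape void}) w o j :
  (tp ord0).2 = [seq Some (inl b) | b <- x] ++ nseq j None ->
  halts D (guess_config (inl None) tp w) o <->
  exists y b, size y = (size x).+1 /\ verdict D (w ++ code x y b) b o.
Proof.
elim: x tp w j => [|a x IH] tp w j tpE.
  have rE : read (tp ord0) = None by rewrite /read tpE; case: (j).
  rewrite halts_step //; split.
    case=> c /step_scan; rewrite rE => -[b ->] /guesser_answer [b' h].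
    by exists [:: b], b'; split=> //; rewrite -!cats1 -catA in h.
  case=> -[|c [|? ?]] [b [//= _ h]].
  exists (guess_config (inl (Some true)) (guess_move tp Stay) (rcons w c)).
    by apply/step_scan; rewrite rE; exists c.
  by apply/guesser_answer; exists b; rewrite -!cats1 -catA.
have rE : read (tp ord0) = Some (inl a) by rewrite /read tpE.
have tpE' : exists j', (guess_move (guess_move tp MoveRight) Stay ord0).2 =
    [seq Some (inl b) | b <- x] ++ nseq j' None.
  rewrite !ffunE /read /= tpE /=; case: (x) => [|? ?] /=; last by exists j.
  by exists (j.-1).+1; case: (j).
have [j' {}tpE'] := tpE'.
rewrite halts_step //; split.
  case=> c /step_scan; rewrite rE => ->.
  rewrite halts_step // => -[c' /step_guess [b ->]].
  rewrite (IH _ _ _ tpE') => -[y [b' [sy h]]].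
  exists (b :: y), b'; split; first by rewrite /= sy.
  by rewrite -!cats1 -!catA in h.
case=> -[|c y] [b [//= [sy] h]].
exists (guess_config (inl (Some false)) (guess_move tp MoveRight) (rcons w a)).
  by apply/step_scan; rewrite rE.
rewrite halts_step //.
exists (guess_config (inl None) (guess_move (guess_move tp MoveRight) Stay) (rcons (rcons w a) c)).
  by apply/step_guess; exists c.
rewrite (IH _ _ _ tpE').
by exists y, b; split=> //; rewrite -!cats1 -!catA.
Qed.

Lemma out_guesser D x o : out guesser D x o <->
  exists y b, size y = (size x).+1 /\ verdict D (code x y b) b o.
Proof.
apply: (@guesser_halts D x (ctapes (init guesser x)) [::] o 0).
by rewrite /= ffunE cats0.
Qed.

Lemma codes_SN A B : correct_codes A B -> le_SN A B.
Proof.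
move=> [sound complete].
have outE x b : out guesser B x (outcome_of b) <-> (b <-> A x).
  rewrite out_guesser; split.
    move=> [y [b' [sy [[h e]|[_ e]]]]]; last by case: b e.
    by have := sound _ _ _ sy h; move: e; case: b; case: b' h.
  have [y sy [b' h]] := complete x; have hb := sound _ _ _ sy h.
  move=> bA; exists y, b'; split=> //; left; split=> //.
  by congr outcome_of; apply/idP/idP; tauto.
exists guesser; split.
- exact: guesser_nptm.
- move=> x e; have [Ax|nAx] := pselect (A x).
    have /outE : true <-> A x by [].
    by rewrite e.
  have /outE : false <-> A x by split.
  by rewrite e.
- move=> x h.
  have /(outE x true) [h1 _] : out guesser B x (outcome_of true) by apply: h; left.
  have /(outE x false) [_ h2] : out guesser B x (outcome_of false) by apply: h; right.
  by have := h2 (h1 isT).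
- apply/seteqP; split=> x; rewrite /lang /= -[Acc]/(outcome_of true) outE; first by split.
  by case=> h _; exact: h.
Qed.

(** * There are countably many machines *)

Definition kind_code (k : nat) : finType := option ('I_k * 'I_k + option bool)%type.

Definition decode_kind k (c : kind_code k) : state_kind 'I_k :=
  match c with
  | None => Compute
  | Some (inl (y, n)) => Ask y n
  | Some (inr (Some b)) => Halt (if b then Acc else Rej)
  | Some (inr None) => Halt Unk
  end.

Definition encode_kind (Q : finType) (q : state_kind Q) : kind_code #|Q| :=
  match q with
  | Compute => None
  | Ask y n => Some (inl (enum_rank y, enum_rank n))
  | Halt Acc => Some (inr (Some true))
  | Halt Rej => Some (inr (Some false))
  | Halt Unk => Some (inr None)
  end.

Definition table_code (p : nat * nat * nat) : finType :=
  let: (k, j, t) := p in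
  ('I_k * {ffun 'I_k -> kind_code k} *
   {ffun 'I_k * {ffun 'I_t.+1 -> symbol 'I_j} ->
     {set 'I_k * {ffun 'I_t.+1 -> symbol 'I_j * move} * option bool}})%type.

(** A [machine] carries arbitrary finite types, so it cannot be enumerated as it stands. Renaming
    states and auxiliary symbols by their ranks makes it an element of a countable type and
    preserves its runs. *)
Definition machine_code : countType := {p : nat * nat * nat & table_code p}.

Definition machine_of k j t (c : table_code (k, j, t)) : machine :=
  @Machine 'I_k 'I_j t c.1.1 (fun q => decode_kind (c.1.2 q)) (fun q r => c.2 (q, r)).

Definition decode (c : machine_code) : machine :=
  let: existT p c := c in
  match p return table_code p -> machine with (k, j, t) => @machine_of k j t end c.

Section Standardize.
Variable N : machine.
Notation k := #|state N|.
Notation j := #|aux N|.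

Definition of_symbol (s : symbol 'I_j) : symbol (aux N) :=
  match s with
  | Some (inl b) => Some (inl b)
  | Some (inr a) => Some (inr (enum_val a))
  | None => None
  end.

Definition to_symbol (s : symbol (aux N)) : symbol 'I_j :=
  match s with
  | Some (inl b) => Some (inl b)
  | Some (inr a) => Some (inr (enum_rank a))
  | None => None
  end.

Lemma of_symbolK : cancel of_symbol to_symbol.
Proof. by case=> [[b|a]|] //=; rewrite enum_valK. Qed.

Lemma to_symbolK : cancel to_symbol of_symbol.
Proof. by case=> [[b|a]|] //=; rewrite enum_rankK. Qed.

Definition of_action (a : 'I_k * {ffun 'I_(ntapes N).+1 -> symbol 'I_j * move} * option bool) :
    state N * {ffun 'I_(ntapes N).+1 -> symbol (aux N) * move} * option bool :=
  (enum_val a.1.1, [ffun i => (of_symbol (a.1.2 i).1, (a.1.2 i).2)], a.2).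

Definition code_of : table_code (k, j, ntapes N) :=
  (enum_rank (start N), [ffun q => encode_kind (kind (enum_val q))],
   [ffun qr : 'I_k * {ffun 'I_(ntapes N).+1 -> symbol 'I_j} =>
     [set a | of_action a \in trans (enum_val qr.1) [ffun i => of_symbol (qr.2 i)]]%SET]).

Definition standard : machine := machine_of code_of.

Definition of_standard (c : config standard) : config N :=
  Config (enum_val (cstate c : 'I_k))
    [ffun i => (map of_symbol (ctapes c i).1, map of_symbol (ctapes c i).2)] (coracle c).

Definition to_standard (c : config N) : config standard :=
  @Config standard (enum_rank (cstate c))
    [ffun i => (map to_symbol (ctapes c i).1, map to_symbol (ctapes c i).2)] (coracle c).

Lemma to_standardK : cancel to_standard of_standard.
Proof.
case=> q tp w; rewrite /of_standard /to_standard /= enum_rankK; congr Config.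
apply/ffunP => i; rewrite !ffunE /= !mapK; try exact: to_symbolK.
by case: (tp i).
Qed.

Lemma of_standardK : cancel of_standard to_standard.
Proof.
case=> q tp w; rewrite /of_standard /to_standard /= enum_valK; congr Config.
apply/ffunP => i; rewrite !ffunE /= !mapK; try exact: of_symbolK.
by case: (tp i).
Qed.

Lemma kind_standard (q : 'I_k) :
  @kind standard q = match kind (enum_val q) with
    | Compute => Compute
    | Ask y n => Ask (enum_rank y) (enum_rank n)
    | Halt o => Halt o end.
Proof. by rewrite /= ffunE; case: kind => // -[]. Qed.

Lemma read_map tp : read (map of_symbol tp.1, map of_symbol tp.2) = of_symbol (read tp).
Proof. by case: tp => l [|a r]. Qed.

Lemma write_move_map tp a :
  write_move (map of_symbol tp.1, map of_symbol tp.2) (of_symbol a.1, a.2) =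
  (map of_symbol (write_move tp a).1, map of_symbol (write_move tp a).2).
Proof. by case: tp => [[|? l] [|? r]]; case: a => s []. Qed.

Lemma step_standard D (c c' : config standard) :
  step D c c' <-> step D (of_standard c) (of_standard c').
Proof.
rewrite /step kind_standard [cstate (of_standard c)]/=.
case E: (kind (enum_val _)) => [|y n|o] //.
  have rE : [ffun i => of_symbol ([ffun i => read (ctapes c i)] i)] =
     [ffun i => read (ctapes (of_standard c) i)].
    by apply/ffunP => i; rewrite !ffunE read_map.
  have cE (a : 'I_k * {ffun 'I_(ntapes N).+1 -> symbol 'I_j * move} * option bool) :
    of_standard (@Config standard a.1.1 [ffun i => write_move (ctapes c i) (a.1.2 i)]
       (append (coracle c) a.2)) =
    Config (of_action a).1.1 [ffun i => write_move (ctapes (of_standard c) i) ((of_action a).1.2 i)]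
       (append (coracle (of_standard c)) (of_action a).2).
    by congr Config; apply/ffunP => i; rewrite !ffunE write_move_map.
  split.
    case=> a; rewrite /= ffunE inE /= rE => ha ->; exists (of_action a) => //.
  case=> a ha e.
  pose b : 'I_k * {ffun 'I_(ntapes N).+1 -> symbol 'I_j * move} * option bool :=
    (enum_rank a.1.1, [ffun i => (to_symbol (a.1.2 i).1, (a.1.2 i).2)], a.2).
  have bE : of_action b = a.
    case: a {ha e} @b => -[q m] o; rewrite /of_action /= enum_rankK; congr (_, _, _).
    by apply/ffunP => i; rewrite !ffunE /= to_symbolK; case: (m i).
  exists b; first by rewrite /= ffunE inE /= rE bE.
  by apply: (can_inj of_standardK); rewrite e cE bE.
have cE z : of_standard (@Config standard (enum_rank z) (ctapes c) [::]) =
    Config z (ctapes (of_standard c)) [::] by rewrite /of_standard /= enum_rankK.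
split; case=> -[h e]; [left|right|left|right]; split=> //.
- by rewrite e cE.
- by rewrite e cE.
- by apply: (can_inj of_standardK); rewrite e cE.
- by apply: (can_inj of_standardK); rewrite e cE.
Qed.

Lemma steps_standard D n (c c' : config standard) :
  steps D n c c' <-> steps D n (of_standard c) (of_standard c').
Proof.
elim: n c => [|n IH] c /=.
  by split=> [->|/(can_inj of_standardK)].
split; first by case=> d /step_standard h1 /IH h2; exists (of_standard d).
by case=> d; rewrite -(to_standardK d) => /step_standard h1 /IH h2; exists (to_standard d).
Qed.

Lemma of_standard_init x : of_standard (init standard x) = init N x.
Proof.
rewrite /of_standard /init /= enum_rankK; congr Config.
apply/ffunP => i; rewrite !ffunE.
by case: ifP => //= _; rewrite -map_comp.
Qed.

Lemma out_standard D x : out standard D x = out N D x.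
Proof.
have hk c o : kind (cstate c : state standard) = Halt o <-> kind (cstate (of_standard c)) = Halt o.
  by rewrite kind_standard /=; case: kind => // ?; split; case=> ->.
apply/seteqP; split=> o [n [c [st kc]]].
  exists n, (of_standard c); split; last exact/hk.
  by rewrite -of_standard_init; apply/steps_standard.
exists n, (to_standard c); split; last by apply/hk; rewrite to_standardK.
by apply/steps_standard; rewrite of_standard_init to_standardK.
Qed.

Lemma nptm_standard : nptm N -> nptm standard.
Proof.
move=> [h1 [p h2]]; split.
  move=> D x n c /steps_standard; rewrite of_standard_init => /h1 [[o ko]|[c' st]].
    by left; exists o; rewrite kind_standard; move: ko => /= ->.
  by right; exists (to_standard c'); apply/step_standard; rewrite to_standardK.
by exists p => D x n c /steps_standard; rewrite of_standard_init => /h2.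
Qed.
End Standardize.

Lemma machines_countable : exists E : nat -> machine, forall N, exists n,
  (forall D x, out (E n) D x = out N D x) /\ (nptm N -> nptm (E n)).
Proof.
(* The value at numbers that code no machine. *)
pose M0 := @Machine unit void 0 tt (fun=> Compute) (fun _ _ => finset.set0).
exists (fun n => if unpickle n is Some c then decode c else M0) => N.
exists (pickle (existT (fun p => table_code p) (_, _, _) (code_of N) : machine_code)).
rewrite pickleK; split; first exact: out_standard.
exact: nptm_standard.
Qed.

(** * Diagonalisation *)

Lemma poly_bounded_horner (p : {poly nat}) : poly_bounded (fun n => p.[n]%R).
Proof.
elim/poly_ind: p => [|p c IH].
  by have [k hk] := poly_bounded_const 0; exists k => n; rewrite horner0.
have [k hk] := poly_boundedD (poly_boundedM IH poly_bounded_id) (poly_bounded_const c).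
by exists k => n; rewrite hornerMXaddC; exact: hk.
Qed.

Lemma expn_gt_poly k : exists m, forall n, m <= n -> n ^ k < 2 ^ n.
Proof.
(* With [q = n %/ k.+1], [n] is at most [k.+1 * 2 ^ q]. The bound makes [q] at least [k.+1 ^ k], so
   [k.+1 ^ k < 2 ^ q] and [n ^ k < 2 ^ (q * k.+1)]. *)
exists (k.+1 ^ k * k.+1) => n le.
have q_ge : k.+1 ^ k <= n %/ k.+1 by rewrite leq_divRL.
set q := n %/ k.+1 in q_ge.
apply: (@leq_ltn_trans ((k.+1 * 2 ^ q) ^ k)).
  case: (k) @q q_ge => // k' q _; rewrite leq_exp2r //.
  apply: leq_trans (ltnW (ltn_ceil n (isT : 0 < k'.+2))) _.
  by rewrite mulnC leq_mul // -/q ltn_expl.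
rewrite expnMn -expnM; apply: (@leq_trans (2 ^ q * 2 ^ (q * k))).
  by rewrite ltn_mul2r expn_gt0 /= (leq_ltn_trans q_ge) // ltn_expl.
by rewrite -expnD leq_exp2l // -mulnS leq_trunc_div.
Qed.

Lemma expn_gt_shift k : exists m, forall n, m <= n -> (n + 2) ^ k < 2 ^ n.+1.
Proof.
(* The extra factor [n + 2], which is at least two, pays for having the exponent [n + 2] in place of
   [n.+1]. *)
have [m hm] := expn_gt_poly k.+1; exists m => n le.
have := hm (n + 2) (leq_trans le (leq_addr _ _)).
rewrite -(@ltn_pmul2l 2 ((n + 2) ^ k)) // -[2 * 2 ^ _]expnS [in 2 ^ _]addn2.
apply: leq_ltn_trans.
by rewrite expnS leq_mul2r leq_addl orbT.
Qed.

Lemma val_nseq_true k : (val_word (nseq k true)).+2 = 2 ^ k.+1.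
Proof. by elim: k => //= k IH; rewrite expnS -IH; lia. Qed.

Definition agree (l : nat) (B B' : language) : Prop :=
  forall w, size w < l -> B w <-> B' w.

Definition robust (N : machine) : Prop :=
  [/\ nptm N, robustly_overproductive N & robustly_underproductive N].

Section Forcing.
Variables (A : language) (N : machine).
Hypothesis hN : robust N.

Lemma robust_exclusive D x : out N D x Acc -> out N D x Rej -> False.
Proof.
by case: hN => _ _ /(_ D x) h a r; apply: h => o [->|->].
Qed.

Lemma robust_time : exists k, forall D x n c,
  steps D n (init N x) c -> n <= (size x + 2) ^ k.
Proof.
case: hN => -[_ [p hp]] _ _; have [k hk] := poly_bounded_horner p.
by exists k => D x n c /hp h; apply: leq_trans h (hk _).
Qed.

Lemma robust_decides D x : exists n c b,
  steps D n (init N x) c /\ kind (cstate c) = Halt (outcome_of b).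
Proof.
have [[live [p hp]] over _] := hN; apply: contrapT => none.
have unk o : out N D x o -> o = Unk.
  by case: o => // -[n [c h]]; case: none; exists n, c; [exists true|exists false].
apply: (over D x); apply/seteqP; split=> o /=; first exact: unk.
move=> ->; apply: contrapT => nounk.
(* An empty set of outcomes also differs from [[set Unk]]. It is impossible because every path could
   then be prolonged, beyond the polynomial bound. *)
have long n : exists c, steps D n (init N x) c.
  elim: n => [|n [c st]]; first by exists (init N x).
  have [[o' ko]|[c' cc']] := live _ _ _ _ st.
    have ho : out N D x o' by exists n, c.
    by case: nounk; rewrite -(unk o' ho).
  by exists c'; rewrite -addn1; apply: steps_cat st _; exists c'.
have [c /hp] := long p.[size x]%R.+1.
by rewrite ltnn.
Qed.

Section Stage.
Variables (B0 : language) (m : nat).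
Hypothesis m_gt0 : 0 < m.
Hypothesis codes0 : correct_codes A B0.
Hypothesis forced : forall B, correct_codes A B -> agree m.*2.+1 B B0 -> A = lang N B.

(** Codes of [x] have length [2 * (size x + 1)], so cutting [B0] at [m.*2.+1] keeps all codes of
    words shorter than [m] and none of the others. *)
Definition stage (i : nat) : language :=
  [set w | (size w < m.*2.+1 /\ B0 w) \/
     exists x, [/\ m <= size x, val_word x < i & w = zero_code x `[< A x >]]].

(** The last word of length [m.-1]. Its successor, of index [i_start], is the first word of length
    [m], and the first whose answer the program computes. *)
Definition X_start : word := nseq m.-1 true.
Definition i_start : nat := (val_word X_start).+1.

Lemma i_start_size x : (i_start <= val_word x) = (m <= size x).
Proof.
have e : i_start.+1 = 2 ^ m by rewrite /i_start val_nseq_true prednK.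
have h1 := val_word_ge x; have h2 := val_word_lt x.
apply/idP/idP => h.
  by rewrite -ltnS -(ltn_exp2l (m := 2)) // -e; lia.
by rewrite -ltnS e; apply: leq_trans h1; rewrite leq_exp2l.
Qed.

Lemma zero_code_size x b : m <= size x -> m.*2.+1 <= size (zero_code x b).
Proof. by rewrite -code_zeros size_code; lia. Qed.

Lemma stage_correct_claim i x n c o : i_start <= i -> steps (stage i) n (init N x) c ->
  kind (cstate c) = Halt o -> (forall z, i <= val_word z -> n < 2 ^ (size z).+1) ->
  claims A o x.
Proof.
move=> le st kc small; have [qs qsn use] := steps_use st.
(* For the words of index at least [i], [B] gets every code with the right answer except those the
   path queries. The path thus sees the same answers as in [stage i], and by counting, each of these
   words still has a code. *)
pose B : language := [set w | stage i w \/ exists z y,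
  [/\ i <= val_word z, size y = (size z).+1, w = code z y `[< A z >] & w \notin qs]].
have large z : i <= val_word z -> m <= size z.
  by move=> iz; rewrite -i_start_size (leq_trans le).
have codesB : correct_codes A B.
  split=> [z y b sy [[[_ h]|[z' [_ _ h]]]|[z' [y' [_ sy' h _]]]]|z].
  - exact: (proj1 codes0) sy h.
  - move: h; rewrite -code_zeros => /code_inj; rewrite size_nseq sy => /(_ erefl erefl).
    by case=> -> _ ->; split=> /asboolP.
  - by move: h => /code_inj; rewrite sy sy' => /(_ erefl erefl) [-> _ ->]; split=> /asboolP.
  have [zm|mz] := ltnP (size z) m.
    have [y sy [b h]] := proj2 codes0 z; exists y => //; exists b; left; left; split=> //.
    by rewrite size_code; lia.
  have [zi|iz] := ltnP (val_word z) i.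
    exists (nseq (size z).+1 false); first by rewrite size_nseq.
    by exists `[< A z >]; left; right; exists z; rewrite code_zeros.
  have [y sy nin] := code_avoid `[< A z >] (leq_ltn_trans qsn (small z iz)).
  by exists y => //; exists `[< A z >]; right; exists z, y.
have agreeB : agree m.*2.+1 B B0.
  move=> w ws; split; last by left; left.
  case=> [[[]//|[z [mz _ e]]]|[z [y [iz _ e _]]]].
    by move: ws; rewrite e ltnNge zero_code_size.
  by move: ws (large z iz); rewrite e size_code; lia.
have hB := forced codesB agreeB.
have ho : out N B x o.
  exists n, c; split=> //; apply: use => w wqs; split; first by left.
  by case=> // -[z [y [_ _ _]]]; rewrite wqs.
have AE : A x <-> out N B x Acc by rewrite {1}hB.
(* If the path rejects, [A x] would give an accepting path of [N] with the same oracle [B], against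
   underproductivity. *)
by case: o ho {kc} => // h; [apply/AE|move=> /AE a; apply: robust_exclusive a h].
Qed.

Definition prefix_words : seq word :=
  [seq w <- [seq word_of i | i <- iota 0 (2 ^ m.*2.+1)] |
     (size w < m.*2.+1) && `[< B0 w >]].

Lemma mem_prefix_words w : (w \in prefix_words) <-> (size w < m.*2.+1 /\ B0 w).
Proof.
rewrite mem_filter; split; first by case/andP => /andP [-> /asboolP].
case=> ws hw; rewrite ws (introT (asboolP _) hw) /=.
rewrite -(val_wordK w) map_f // mem_iota /= add0n.
apply: leq_trans (ltnW (val_word_lt w)) _.
by rewrite leq_exp2l.
Qed.

Definition prefix_table := [seq bits N (rev w) | w <- prefix_words].

Lemma forced_NP target : (exists k, (forall D x n c,
  steps D n (init N x) c -> n <= (size x + 2) ^ k) /\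
  (forall n, m <= n -> (n + 2) ^ k < 2 ^ n.+1)) ->
  target <> Unk -> NP (claims A target).
Proof.
move=> [k [hk mk]] ht.
apply: (@claims_NP N target prefix_table X_start A stage i_start k) => //.
- apply/seteqP; split=> w; rewrite /table_lang /=.
    by case/mapP => v /mem_prefix_words hv /bits_inj /(can_inj revK) ->; left.
  case; first by move=> /mem_prefix_words h; apply/mapP; exists w.
  by move=> [x [mx + _]]; rewrite -i_start_size in mx; rewrite ltnNge mx.
- by apply/allP => e /mapP [w _ ->]; apply/mapP => -[].
- move=> i w le; split.
    case=> [h|[x [mx xi e]]]; first by right; left.
    move: xi; rewrite ltnS leq_eqVlt => /orP [/eqP xi|xi].
      by left; rewrite e -xi val_wordK.
    by right; right; exists x.
  case=> [->|[h|[x [mx xi e]]]]; [right|by left|right].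
    exists (word_of i); split=> //; last by rewrite word_ofK.
    by rewrite -i_start_size word_ofK.
  by exists x; split=> //; apply: ltnW.
- exact: robust_decides.
- by move=> z; rewrite i_start_size => /mk.
- exact: stage_correct_claim.
Qed.
End Stage.

Hypothesis hA : ~ (NP `&` coNP) A.

Lemma escape B0 l : correct_codes A B0 ->
  exists B, [/\ correct_codes A B, agree l B B0 & A <> lang N B].
Proof.
move=> codes0; apply: contrapT => none; apply: hA.
have [k hk] := robust_time; have [m0 hm0] := expn_gt_shift k.
(* This [m] is positive, its cut [m.*2.+1] lies beyond [l], and from length [m] on the time bound of
   [N] on a word is below its number of witnesses. *)
pose m := (maxn l m0).+1.
have forced B : correct_codes A B -> agree m.*2.+1 B B0 -> A = lang N B.
  move=> cB aB; apply: contrapT => ne; apply: none; exists B; split=> // w ws.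
  by apply: aB; rewrite /m; lia.
have np t : t <> Unk -> NP (claims A t).
  move=> ht; apply: (@forced_NP B0 m isT codes0 forced) => //.
  by exists k; split=> // n mn; apply: hm0; rewrite /m in mn; lia.
(* [claims A Acc] is [A], and [claims A Rej] its complement. *)
by split; [exact: (np Acc)|exact: (np Rej)].
Qed.

(** A failure of [N] is witnessed by one path, which depends on finitely many queries. If [N]
    wrongly accepts, this is clear. If it misses an [x] in [A], overproductivity supplies a
    rejecting path, and wherever this path survives, underproductivity forbids acceptance. *)
Lemma escape_open B : A <> lang N B ->
  exists l, forall B', agree l B' B -> A <> lang N B'.
Proof.
move=> ne.
have keep_out x o : out N B x o ->
    exists l, forall B', agree l B' B -> out N B' x o.
  move=> [n [c [/steps_use [qs _ use] kc]]].
  exists (\max_(w <- qs) size w).+1 => B' aB; exists n, c; split=> //; apply: use => w wqs.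
  apply: iff_sym; apply: aB; rewrite ltnS.
  by rewrite (big_rem w) //= leq_maxl.
have [x hx] : exists x, ~ (A x <-> out N B x Acc).
  apply: contrapT => /forallNP h; apply: ne; apply/seteqP; split=> x.
    by have /contrapT h' := h x; move/h'.
  by have /contrapT h' := h x; move/h'.
have [Ax|nAx] := pselect (A x).
  have hr : out N B x Rej.
    have [n [c [b [st kc]]]] := robust_decides B x.
    case: b kc => kc; last by exists n, c.
    by case: hx; split=> // _; exists n, c.
  have [l hl] := keep_out _ _ hr; exists l => B' /hl h e.
  by apply: (robust_exclusive _ h); move: Ax; rewrite {1}e.
have ha : out N B x Acc by apply: contrapT => h; apply: hx; split.
have [l hl] := keep_out _ _ ha; exists l => B' /hl h e.
by apply: nAx; rewrite e.
Qed.
End Forcing.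

(** * Limits of finite extensions *)

Section Limit.
Variable A : language.

Definition extends (c c' : language * nat) : Prop :=
  [/\ correct_codes A c'.1, c.2 < c'.2 & agree c.2 c'.1 c.1].

(** The lengths grow strictly, so a word [w] is settled from stage [size w + 1] on. Correctness
    passes to the limit because it concerns single words, and all codes of one [x] have the same
    length. *)
Lemma extension_limit (c : nat -> language * nat) :
  correct_codes A (c 0).1 -> (forall n, extends (c n) (c n.+1)) ->
  exists2 B, correct_codes A B & forall n, agree (c n).2 B (c n).1.
Proof.
move=> c0 cS.
have codes n : correct_codes A (c n).1 by case: n => // n; case: (cS n).
have len n : n <= (c n).2.
  by elim: n => // n IH; apply: leq_ltn_trans IH _; case: (cS n).
have agree_le n k : agree (c n).2 (c (n + k)).1 (c n).1 /\ (c n).2 <= (c (n + k)).2.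
  elim: k => [|k [IH1 IH2]]; first by rewrite addn0; split.
  rewrite addnS; case: (cS (n + k)) => _ lt ag; split; last by lia.
  by move=> w ws; rewrite (ag w) ?IH1 //; lia.
have agree_all n n' w : size w < (c n).2 -> size w < (c n').2 ->
    (c n).1 w <-> (c n').1 w.
  wlog le : n n' / n <= n' => [h|h1 h2].
    by case/orP: (leq_total n n') => le h1 h2; [|apply: iff_sym]; apply: h.
  by apply: iff_sym; have [ag _] := agree_le n (n' - n); rewrite subnKC // in ag; apply: ag.
exists [set w | (c (size w).+1).1 w]; last first.
  by move=> n w ws; apply: agree_all => //; apply: len.
split=> [x y b sy /=|x]; first exact: (proj1 (codes _)) sy.
(* The codes of [x] have length [(size x).+1.*2], so the limit takes all of them from this one
   stage. *)
have [y sy [b h]] := proj2 (codes (size x).+1.*2.+1) x.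
by exists y => //; exists b; rewrite /= size_code.
Qed.
End Limit.

Theorem theorem3p1 (A : language) (hrec : recursive A)
    (hA : ~ (NP `&` coNP) A) :
  exists B : language, le_SN A B /\ ~ le_RS A B.
Proof.
have [E hE] := machines_countable.
pose avoids n (c : language * nat) := robust (E n) ->
  forall B, agree c.2 B c.1 -> A <> lang (E n) B.
(* Correctness of the given language is a premise inside the existential, so that [choice] yields a
   function defined on all pairs. *)
have step (nc : nat * (language * nat)) : exists c', correct_codes A nc.2.1 ->
    extends A nc.2 c' /\ avoids nc.1 c'.
  case: nc => n [B0 l] /=.
  have [c0|nc0] := pselect (correct_codes A B0); last by exists (B0, l) => /nc0.
  have [rN|nrN] := pselect (robust (E n)); last first.
    by exists (B0, l.+1) => _; split=> //; split.
  have [B [cB aB ne]] := escape rN hA l c0.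
  have [l' hl'] := escape_open rN ne.
  (* [l.+1] makes the fixed length grow, and [l'] preserves what defeats [E n]. *)
  exists (B, maxn l.+1 l') => _; split.
    by split=> //=; rewrite leq_max leqnn.
  by move=> _ B' aB'; apply: hl' => w ws; apply: aB'; rewrite /= leq_max ws orbT.
have [f hf] := choice step.
pose start : language * nat := ([set w | exists x, w = zero_code x `[< A x >]], 0).
pose c := fix c n := if n is n.+1 then f (n, c n) else start.
have codes_start : correct_codes A start.1.
  split=> [x y b sy [x']|x].
    rewrite -code_zeros => /code_inj; rewrite size_nseq sy => /(_ erefl erefl).
    by case=> -> _ ->; split=> /asboolP.
  exists (nseq (size x).+1 false); first by rewrite size_nseq.
  by exists `[< A x >], x; rewrite code_zeros.
have codes n : correct_codes A (c n).1.
  by elim: n => //= n /(hf (n, c n)) [[]].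
have ext n : extends A (c n) (c n.+1) by have [] := hf (n, c n) (codes n).
have [B cB aB] := extension_limit codes_start ext.
exists B; split; first exact: codes_SN.
move=> [N [nN over under AE]].
have [n [outE nE]] := hE N.
have rN : robust (E n).
  split; first exact: nE.
    by move=> D x; rewrite outE; apply: over.
  by move=> D x; rewrite outE; apply: under.
have [_ av] := hf (n, c n) (codes n).
apply: (av rN B (aB n.+1)); rewrite AE; apply/seteqP; split=> x; rewrite /lang /= outE //.
Qed.
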